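(* Let $p$ be a prime, $k\ge1$, $d=p^{k-1}d'$ with an integer $d'\ge2$, and $F\in\mathscr F$. Then $\mathrm{Res}(\mathrm{Lex}^-_{F,d}(k))$ is a $\left[\frac{p^k-1}{p-1}d',\ k,\ p^{k-1}d'\right]$ code over $\mathbb F_p$, which is obtained by repeating the $\left[\frac{p^k-1}{p-1},\ k,\ p^{k-1}\right]$ simplex code $d'$ times.
   Context: $\mathbb N$ is the set of non-negative integers. $\mathbb F_p$ is identified with $\{0,1,\dots,p-1\}$, elements compared as integers. $\mathbb F_p^{\mathbb N}$ is the space of finitely supported sequences $(x_i)_{i\in\mathbb N}$ over $\mathbb F_p$, with standard basis $E=(e_0,e_1,\dots)$. For distinct $\xi,\eta\in\mathbb N$, $F(\xi,\eta)=(f_i)_{i\in\mathbb N}$ is the ordered basis with $f_i=e_i$ for $i\ne\xi$ and $f_\xi=e_\xi+e_\eta$. Let $\mathscr F=\{E\}\cup\{F(\xi,\eta):\xi,\eta\in\mathbb N,\ \xi\neq\eta\}$. For an ordered basis $F=(f_i)$ write $x=\sum_i x_{[i]}f_i$; for $x\neq y$ let $N$ be the largest index with $x_{[N]}\ne y_{[N]}$ and set $x<_F y$ iff $x_{[N]}<y_{[N]}$. The Hamming distance is $d(x,y)=|\{i: x_i\neq y_i\}|$ in standard coordinates. The words $w^-(a)=w^-_{F,d}(a)$ ($a\in\mathbb N$) are defined recursively: if $a$ is a power of $p$ (including $p^0=1$), $w^-(a)$ is the $<_F$-minimum $z\in\mathbb F_p^{\mathbb N}$ with $d(z,w^-(b))\ge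 d$ for all $0\le b<a$; otherwise $w^-(a)=\sum_i a_iw^-(p^i)$ where $a=\sum_i a_ip^i$ is the $p$-ary expansion (so $w^-(0)=0$). Put $\mathrm{Lex}^-_{F,d}(k)=\{w^-(0),\dots,w^-(p^k-1)\}$. For $L\subseteq\mathbb F_p^{\mathbb N}$, $\mathrm{Res}(L)$ is obtained from $L$ by deleting all standard coordinates $i$ at which every element of $L$ is zero. An $[n,k,d]$ code is a linear code of length $n$, dimension $k$ and minimum distance $d$; the simplex code is the code having a generator matrix whose columns are one representative of each one-dimensional subspace of $\mathbb F_p^k$; ''repeating $d'$ times'' means that each column of the generator matrix is repeated $d'$ times, codes being considered up to permutation of coordinates. *)

(* Defs.v *)
From mathcomp Require Import all_boot all_order all_algebra.
From mathcomp Require Import boolp classical_sets.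

Set Implicit Arguments.
Unset Strict Implicit.
Unset Printing Implicit Defensive.

Import GRing.Theory.

Local Open Scope ring_scope.

(* A finitely supported sequence over 'F_p is a polynomial: x_i is x`_i and
   e_i is 'X^i; only the vector space structure is used. *)
Definition fsseq (p : nat) := {poly 'F_p}.

Definition basisE (p : nat) : nat -> fsseq p := fun i => 'X^i.

Definition basisF (p : nat) (xi eta : nat) : nat -> fsseq p :=
  fun i => if i == xi then 'X^xi + 'X^eta else 'X^i.

Definition scrF (p : nat) (F : nat -> fsseq p) : Prop :=
  F = basisE p \/ exists xi eta : nat, xi <> eta /\ F = basisF p xi eta.

Definition lincomb (p : nat) (F : nat -> fsseq p) (c : fsseq p) : fsseq p :=
  \sum_(i < size c) c`_i *: F i.

(* c and c' are the coordinate sequences x_[.] and y_[.] in the basis F;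
   entries of 'F_p are compared through the coercion to nat. *)
Definition ltF (p : nat) (F : nat -> fsseq p) (x y : fsseq p) : Prop :=
  exists c c' : fsseq p,
    [/\ x = lincomb F c, y = lincomb F c' &
        exists N : nat, ((c`_N)%R < (c'`_N)%R)%N /\
          forall i : nat, (N < i)%N -> c`_i = c'`_i].

(* All coordinates from maxn (size x) (size y) on are 0 in both x and y. *)
Definition hamming (p : nat) (x y : fsseq p) : nat :=
  #|[set i : 'I_(maxn (size x) (size y)) | x`_i != y`_i]|.

Definition admissible (p d : nat) (s : seq (fsseq p)) (z : fsseq p) : Prop :=
  forall y, y \in s -> (d <= hamming z y)%N.

Definition is_minF (p : nat) (F : nat -> fsseq p) (P : fsseq p -> Prop)
    (z : fsseq p) : Prop :=
  P z /\ forall z', P z' -> z' <> z -> ltF F z z'.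

(* The next word after s = [:: w 0; ...; w (a - 1)], where a = size s.
   The i-th p-ary digit of a is (a %/ p ^ i) %% p; it is 0 for i >= a. *)
Definition wminus_next (p : nat) (F : nat -> fsseq p) (d : nat)
    (s : seq (fsseq p)) : fsseq p :=
  let a := size s in
  if `[< exists i : nat, a = (p ^ i)%N >]
  then xget 0 (is_minF F (admissible d s))
  else \sum_(i < a) ((a %/ p ^ i) %% p)%N%:R *: s`_(p ^ i).

Fixpoint wminus_prefix (p : nat) (F : nat -> fsseq p) (d n : nat)
    : seq (fsseq p) :=
  if n is n'.+1 then
    rcons (wminus_prefix F d n') (wminus_next F d (wminus_prefix F d n'))
  else [::].

Definition wminus (p : nat) (F : nat -> fsseq p) (d a : nat) : fsseq p :=
  wminus_next F d (wminus_prefix F d a).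

Lemma wminus_prefixE (p : nat) (F : nat -> fsseq p) (d n : nat) :
  wminus_prefix F d n = mkseq (wminus F d) n.
Proof. by elim: n => //= n IHn; rewrite mkseqS -IHn. Qed.

Lemma wminus_pow (p : nat) (F : nat -> fsseq p) (d i : nat) :
  wminus F d (p ^ i) =
  xget 0 (is_minF F (fun z =>
    forall b, (b < p ^ i)%N -> (d <= hamming z (wminus F d b))%N)).
Proof.
rewrite {1}/wminus /wminus_next wminus_prefixE size_mkseq.
case: asboolP => [_|[]]; last by exists i.
congr (xget 0 (is_minF F _)); apply/funext => z; apply/propext; split.
  by move=> zP b b_lt; apply: zP; apply: map_f; rewrite mem_iota.
by move=> zP y /mapP[b]; rewrite mem_iota /= add0n => b_lt ->; apply: zP.
Qed.

Lemma wminus_npow (p : nat) (F : nat -> fsseq p) (d a : nat) :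
  (1 < p)%N -> ~ (exists i : nat, a = (p ^ i)%N) ->
  wminus F d a =
  \sum_(i < a) ((a %/ p ^ i) %% p)%N%:R *: wminus F d (p ^ i).
Proof.
move=> p_gt1 aNpow; rewrite {1}/wminus /wminus_next wminus_prefixE size_mkseq.
case: asboolP => // _; apply: eq_bigr => i _.
have [lt_pia|le_api] := ltnP (p ^ i) a; first by rewrite nth_mkseq.
have lt_api : (a < p ^ i)%N.
  by rewrite ltn_neqAle le_api andbT; apply/eqP => E; apply: aNpow; exists i.
by rewrite divn_small // mod0n !scale0r.
Qed.

Definition LexMinus (p : nat) (F : nat -> fsseq p) (d k : nat)
    : seq (fsseq p) :=
  [seq wminus F d a | a <- iota 0 (p ^ k)].

(* A finite subset L of the sequence space is given as a list. *)
Definition active_coords (p : nat) (L : seq (fsseq p)) : seq nat :=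
  [seq i <- iota 0 (\max_(x <- L) size x) | has (fun x : fsseq p => x`_i != 0) L].

Definition Res (p : nat) (L : seq (fsseq p))
    : {set 'rV['F_p]_(size (active_coords L))} :=
  [set y in [seq \row_j x`_(nth 0%N (active_coords L) j) | x : fsseq p <- L]].

Definition hamming_rV (p n : nat) (x y : 'rV['F_p]_n) : nat :=
  #|[set j | x 0 j != y 0 j]|.

Definition min_distance (p N : nat) (C : {set 'rV['F_p]_N}) (d : nat) : Prop :=
  (exists x y, [/\ x \in C, y \in C, x != y & hamming_rV x y = d]) /\
  (forall x y, x \in C -> y \in C -> x != y -> (d <= hamming_rV x y)%N).

(* [n, k, d] code; N is the length recorded in the type. *)
Definition is_code (p N : nat) (C : {set 'rV['F_p]_N}) (n k d : nat) : Prop :=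
  N = n /\
  exists V : {vspace 'rV['F_p]_N},
    [/\ C =i V, \dim V = k & min_distance C d].

Definition generator_matrix (p k n : nat) (G : 'M['F_p]_(k, n))
    (C : {set 'rV['F_p]_n}) : Prop :=
  row_free G /\ C = [set u *m G | u : 'rV['F_p]_k].

Definition simplex_matrix (p k n : nat) (G : 'M['F_p]_(k, n)) : Prop :=
  (forall j, col j G != 0) /\
  (forall U : {vspace 'cV['F_p]_k},
     \dim U = 1%N -> exists! j, U = <[col j G]>%VS).

Definition is_simplex_code (p k n : nat) (C : {set 'rV['F_p]_n}) : Prop :=
  exists G : 'M['F_p]_(k, n), simplex_matrix G /\ generator_matrix G C.

Fact repeat_index_proof (n r : nat) (j : 'I_(n * r)) : (j %/ r < n)%N.
Proof.
case: r j => [[j]|r j]; first by rewrite muln0.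
by rewrite ltn_divLR.
Qed.

Definition repeat_index (n r : nat) (j : 'I_(n * r)) : 'I_n :=
  Ordinal (repeat_index_proof j).

(* Each column of G repeated r times in a row. *)
Definition repeat_cols (p k n r : nat) (G : 'M['F_p]_(k, n))
    : 'M['F_p]_(k, n * r) :=
  colsub (@repeat_index n r) G.

(* Equality up to a permutation of the coordinates; a bijection between two
   index types is used because the lengths need not be convertible. *)
Definition perm_equiv (p n m : nat) (C : {set 'rV['F_p]_n})
    (D : {set 'rV['F_p]_m}) : Prop :=
  exists f : 'I_n -> 'I_m, bijective f /\ C = [set colsub f x | x in D].

Definition repetition_of (p k n m r : nat) (C : {set 'rV['F_p]_m})
    (S : {set 'rV['F_p]_n}) : Prop :=
  exists (G : 'M['F_p]_(k, n)) (D : {set 'rV['F_p]_(n * r)}),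
    [/\ generator_matrix G S, generator_matrix (repeat_cols r G) D &
        perm_equiv C D].

(* Main.v *)
Require Import Defs.
From mathcomp Require Import all_boot all_order all_algebra.
From mathcomp Require Import boolp classical_sets.

From mathcomp Require Import zify.

Set Implicit Arguments.
Unset Strict Implicit.
Unset Printing Implicit Defensive.

Import GRing.Theory.

Local Open Scope ring_scope.

(* Put r = p^(k-1-j) d' and suppose that the nonzero columns of the words
   w(p^0), ..., w(p^(j-1)) are the vectors with first nonzero entry 1, each
   occurring p r times. Summing the distances from z to all p^j code words
   shows that an admissible z has at least r nonzero coordinates outside the
   support of the code. If it has exactly r, all the distances equal d, and
   summing over the hyperplanes <u, v> = c shows that z takes every value r
   times on the block of each column v. Conversely every z balanced in this
   sense with r nonzero coordinates outside is admissible, so that the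
   minimality of w(p^j) bounds its number of outside coordinates by r and makes
   them all equal to 1. Each old block then splits into p blocks of size r, and
   one new block of size r appears: the hypothesis is reproduced for j + 1.
   For F(xi, eta) with xi < eta the comparison words must have equal coordinates
   at xi and eta; they exist because r >= 2, which is where d' >= 2 enters. *)

(** * Counting distances over a linear code *)

Lemma sum_nat_of_bool (I : finType) (P : pred I) :
  (\sum_i nat_of_bool (P i) = #|[set i | P i]|)%N.
Proof.
rewrite -sum1_card [RHS]big_mkcond; apply: eq_bigr => i _.
by rewrite inE; case: (P i).
Qed.

Definition dot (F : fieldType) (k : nat) (u v : 'rV[F]_k) : F :=
  \sum_l u 0 l * v 0 l.

Lemma dotD (F : fieldType) (k : nat) (u v x : 'rV[F]_k) :
  dot (u + v) x = dot u x + dot v x.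
Proof. by rewrite -big_split; apply: eq_bigr => l _; rewrite mxE mulrDl. Qed.

Lemma dotZ (F : fieldType) (k : nat) (a : F) (u x : 'rV[F]_k) :
  dot (a *: u) x = a * dot u x.
Proof. by rewrite mulr_sumr; apply: eq_bigr => l _; rewrite mxE mulrA. Qed.

Lemma dot0r (F : fieldType) (k : nat) (u : 'rV[F]_k) : dot u 0 = 0.
Proof. by apply: big1 => l _; rewrite mxE mulr0. Qed.

Lemma dot_delta (F : fieldType) (k : nat) (l : 'I_k) (x : 'rV[F]_k) :
  dot (delta_mx 0 l) x = x 0 l.
Proof.
rewrite /dot (bigD1 l) //= big1 ?mxE ?eqxx ?mul1r ?addr0 // => m ne_ml.
by rewrite mxE (negPf ne_ml) mul0r.
Qed.

Lemma dot_eq1 (F : fieldType) (k : nat) (v : 'rV[F]_k) :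
  v != 0 -> exists t, dot t v = 1.
Proof.
case/rV0Pn => l vl; exists ((v 0 l)^-1 *: delta_mx 0 l).
by rewrite dotZ dot_delta mulVf.
Qed.

(** Translation by [(c - c') *: t] carries one fibre of [dot _ v] onto the other and preserves
    [Q]. *)
Lemma card_fibre_shift (F : finFieldType) (k : nat) (t v : 'rV[F]_k)
    (Q : pred 'rV[F]_k) (c c' : F) :
  dot t v = 1 -> (forall a u, Q (u + a *: t) = Q u) ->
  #|[set u | Q u & dot u v == c]| = #|[set u | Q u & dot u v == c']|.
Proof.
move=> tv QP; pose h (u : 'rV[F]_k) := u + (c - c') *: t.
have h_inj : injective h by apply: addIr.
rewrite -(card_preimset _ h_inj); apply: eq_card => u; rewrite !inE QP.
by rewrite dotD dotZ tv mulr1 addrCA eq_sym -subr_eq0 opprD addrA subrr add0r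
  opprB subr_eq0 eq_sym.
Qed.

Lemma card_hyperplane (F : finFieldType) (k : nat) (v : 'rV[F]_k) (c : F) :
  v != 0 -> (#|[set u | dot u v == c]| * #|F| = #|F| ^ k)%N.
Proof.
case/dot_eq1 => t tv.
have -> : (#|F| ^ k)%N = #|'rV[F]_k| by rewrite card_mx mul1n.
transitivity (\sum_(c' : F) #|[set u | dot u v == c]|)%N.
  by rewrite sum_nat_const mulnC.
rewrite -[RHS]sum1_card (partition_big (fun u => dot u v) predT) //=.
apply: eq_bigr => c' _; rewrite sum1dep_card.
have := card_fibre_shift c c' (Q := predT) tv (fun _ _ => erefl).
by rewrite !cardsE => ->.
Qed.

Section Counting.

Variables (F : finFieldType) (k : nat) (I : finType).
Variables (g : I -> 'rV[F]_k) (z : I -> F).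

Local Notation q := #|F|.

(** The [g i] are the columns of a generator matrix, so this is the distance from [z] to the code
    word with message [u]. *)
Definition disagree (u : 'rV[F]_k) := #|[set i | z i != dot u (g i)]|.

Definition inner := [set i | g i != 0].

Definition outer := [set i | (g i == 0) && (z i != 0)].

(** Double counting: a nonzero column disagrees with [z i] for all messages off one hyperplane, a
    zero column for all messages or for none. The factor [q] keeps [q ^ (k - 1)] out of the
    formula. *)
Lemma sum_disagree :
  (q * \sum_u disagree u = q ^ k * (q.-1 * #|inner| + q * #|outer|))%N.
Proof.
have q_gt0 : (0 < q)%N by apply/card_gt0P; exists 0.
have -> : (\sum_u disagree u =
    \sum_i #|[set u : 'rV[F]_k | z i != dot u (g i)]|)%N.
  transitivity (\sum_(u : 'rV[F]_k) \sum_i (z i != dot u (g i)))%N.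
    by apply: eq_bigr => u _; rewrite sum_nat_of_bool.
  rewrite exchange_big; apply: eq_bigr => i _.
  by rewrite sum_nat_of_bool.
rewrite big_distrr -[#|inner|]sum1_card -[#|outer|]sum1_card /=.
rewrite ![(_ * \sum_(_ in _) _)%N]big_distrr /=.
rewrite [X in (X + _)%N]big_mkcond [X in (_ + X)%N]big_mkcond -big_split /=.
rewrite big_distrr /=; apply: eq_bigr => i _; rewrite !inE !muln1.
have card_all : #|'rV[F]_k| = (q ^ k)%N by rewrite card_mx mul1n.
case: (altP (g i =P 0)) => [-> | gi_neq0] /=.
  under eq_finset => u do rewrite dot0r.
  case: (z i != 0); rewrite ?addn0 ?add0n ?muln0.
    by rewrite cardsT card_all mulnC.
  by rewrite cards0 muln0.
rewrite addn0.
have := card_hyperplane (z i) gi_neq0.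
have := cardsC [set u : 'rV[F]_k | dot u (g i) == z i].
rewrite card_all => <- hyp.
have -> : [set u : 'rV[F]_k | z i != dot u (g i)] =
    ~: [set u | dot u (g i) == z i].
  by apply/setP => u; rewrite !inE eq_sym.
move: hyp; rewrite -(prednK q_gt0) /= mulnS => /addnI <-.
by rewrite mulSn mulnDl [X in (_ + X)%N]mulnC.
Qed.

Lemma inner_outer_ge (d : nat) :
  (forall u, d <= disagree u)%N ->
  (q * d <= q.-1 * #|inner| + q * #|outer|)%N.
Proof.
move=> d_le; have q_gt0 : (0 < q)%N by apply/card_gt0P; exists 0.
rewrite -(leq_pmul2l (m := q ^ k)) ?expn_gt0 ?q_gt0 // -sum_disagree mulnCA.
rewrite leq_mul2l; apply/orP; right.
have -> : (q ^ k * d = \sum_(u : 'rV[F]_k) d)%N.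
  by rewrite sum_nat_const card_mx mul1n.
exact: leq_sum.
Qed.

(** When the averaging bound is attained, no distance can exceed [d]. *)
Lemma disagree_const (d : nat) :
  (forall u, d <= disagree u)%N ->
  (q * d = q.-1 * #|inner| + q * #|outer|)%N ->
  forall u, disagree u = d.
Proof.
move=> d_le eq_d u; have q_gt0 : (0 < q)%N by apply/card_gt0P; exists 0.
have : (\sum_(u : 'rV[F]_k) d = \sum_u disagree u)%N.
  apply/eqP; rewrite -(eqn_pmul2l q_gt0) sum_disagree -eq_d mulnCA.
  by rewrite sum_nat_const card_mx mul1n.
move=> /eqP; rewrite (leqif_sum (fun u _ => leqif_eq (d_le u))).
by move=> /forallP/(_ u)/eqP.
Qed.

(** Count the agreements of [z] with the code words satisfying [dot u v = e]. Constant distances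
    make the total independent of [e], and the vectors [t] make the share of each column other than
    [v] take the same value for [c] and [c']. So does the share of the columns equal to [v], where
    agreement means [z i = e]. *)
Lemma balanced_of_disagree_const (d : nat) (v : 'rV[F]_k) (c c' : F) :
  v != 0 -> (forall u, disagree u = d) ->
  (forall i, g i != 0 -> g i != v -> exists t, dot t v = 1 /\ dot t (g i) = 0) ->
  #|[set i | (g i == v) && (z i == c)]| = #|[set i | (g i == v) && (z i == c')]|.
Proof.
move=> v_neq0 dis sep; have q_gt0 : (0 < q)%N by apply/card_gt0P; exists 0.
pose h (e : F) i := #|[set u : 'rV[F]_k | dot u (g i) == z i & dot u v == e]|.
pose H (e : F) := #|[set u : 'rV[F]_k | dot u v == e]|.
have H_const e : (H e * q = q ^ k)%N by apply: card_hyperplane.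
have HE e e' : H e = H e'.
  by apply/eqP; rewrite -(eqn_pmul2r q_gt0) !H_const.
have sumh e : (\sum_i h e i = H e * (#|I| - d))%N.
  transitivity (\sum_(u in [set u : 'rV[F]_k | dot u v == e]) (#|I| - d))%N.
    transitivity (\sum_(u in [set u : 'rV[F]_k | dot u v == e])
        \sum_i (dot u (g i) == z i))%N.
      rewrite exchange_big; apply: eq_bigr => i _; rewrite /h -sum1_card.
      rewrite big_mkcond [RHS]big_mkcond; apply: eq_bigr => u _ /=.
      by rewrite !inE; do 2!case: (_ == _).
    apply: eq_bigr => u _; rewrite sum_nat_of_bool.
    rewrite -(dis u) /disagree -(cardsC [set i | dot u (g i) == z i]).
    have -> : [set i | z i != dot u (g i)] = ~: [set i | dot u (g i) == z i].
      by apply/setP => i; rewrite !inE eq_sym.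
    by rewrite addnK.
  by rewrite sum_nat_const.
have hNv i : g i != v -> h c i = h c' i.
  move=> gi_neq.
  have [t [tv tg]] : exists t, dot t v = 1 /\ dot t (g i) = 0.
    have [gi0|/sep] := eqVneq (g i) 0; last exact.
    by have [t tv] := dot_eq1 v_neq0; exists t; rewrite gi0 dot0r.
  rewrite /h; apply: (card_fibre_shift (t := t)) => // a u.
  by rewrite dotD dotZ tg mulr0 addr0.
have hv e : (\sum_(i | g i == v) h e i =
    H e * #|[set i | (g i == v) && (z i == e)]|)%N.
  rewrite mulnC -sum_nat_const big_mkcond [RHS]big_mkcond.
  apply: eq_bigr => i _; rewrite inE; have [gi_v|//] := eqVneq (g i) v.
  have [zi_e|zi_e] /= := eqVneq (z i) e.
    by apply: eq_card => u; rewrite !inE gi_v zi_e andbb.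
  apply/eqP; rewrite cards_eq0; apply/eqP/setP => u; rewrite !inE gi_v.
  by apply/negP => /andP[/eqP-> /eqP ze]; rewrite ze eqxx in zi_e.
have H_gt0 : (0 < H c)%N.
  by have := H_const c; case: (H c) => //; rewrite mul0n => /esym/eqP;
    rewrite expn_eq0 eqn0Ngt q_gt0.
have := sumh c; rewrite (HE c c') -sumh.
rewrite (bigID (fun i => g i == v)) /= [RHS](bigID (fun i => g i == v)) /=.
have -> : (\sum_(i | g i != v) h c i = \sum_(i | g i != v) h c' i)%N.
  by apply: eq_bigr => i /hNv.
move=> /addIn /eqP; rewrite !hv (HE c' c) eqn_pmul2l //.
by move/eqP.
Qed.

(** For every [u], exactly a [q]-th of the block of [v] agrees with [dot u v], so every code word
    lies at the average distance. *)
Lemma disagree_ge_of_balanced (d : nat) :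
  (forall v : 'rV[F]_k, v != 0 -> forall c,
     (#|[set i | (g i == v) && (z i == c)]| * q = #|[set i | g i == v]|)%N) ->
  (q * d <= q.-1 * #|inner| + q * #|outer|)%N ->
  forall u, (d <= disagree u)%N.
Proof.
move=> bal d_le u; have q_gt0 : (0 < q)%N by apply/card_gt0P; exists 0.
rewrite -(leq_pmul2l q_gt0) (leq_trans d_le) //.
have -> : disagree u =
    (#|[set i in inner | z i != dot u (g i)]| + #|outer|)%N.
  rewrite /disagree -(cardsID inner) addnC [RHS]addnC; congr (_ + _)%N.
    apply: eq_card => i; rewrite !inE negbK.
    by have [->|//] := eqVneq (g i) 0; rewrite dot0r.
  by apply: eq_card => i; rewrite !inE andbC.
rewrite mulnDr leq_add2r.
suff : (#|[set i in inner | z i == dot u (g i)]| * q = #|inner|)%N.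
  have := cardsID [set i | z i == dot u (g i)] inner.
  have -> : [set i in inner | z i != dot u (g i)] =
      inner :\: [set i | z i == dot u (g i)].
    by apply/setP => i; rewrite !inE andbC.
  have -> : [set i in inner | z i == dot u (g i)] =
      inner :&: [set i | z i == dot u (g i)].
    by apply/setP => i; rewrite !inE.
  by rewrite -(prednK q_gt0) /=; nia.
transitivity (\sum_(v : 'rV[F]_k | v != 0%R) #|[set i | g i == v]|)%N; last first.
  rewrite -sum1_card (partition_big g (fun v => v != 0)) => [|i]; last by rewrite inE.
  apply: eq_bigr => v v_neq0; rewrite -sum1_card; apply: eq_bigl => i.
  by rewrite !inE; have [->|] := eqVneq (g i) v; rewrite ?v_neq0 ?andbF.
rewrite -sum1_card (partition_big g (fun v => v != 0)) => [|i]; last first.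
  by rewrite !inE => /andP[].
rewrite big_distrl /=; apply: eq_bigr => v v_neq0; rewrite -(bal v v_neq0 (dot u v)).
apply/eqP; rewrite eqn_pmul2r // -sum1_card; apply/eqP.
apply: eq_bigl => i; rewrite !inE.
by have [->|] := eqVneq (g i) v; rewrite ?v_neq0 ?andbF ?andbT.
Qed.

End Counting.

(** * Labellings that are balanced on blocks *)

Lemma map_index (T : eqType) (s : seq T) :
  uniq s -> [seq index x s | x <- s] = iota 0 (size s).
Proof.
case: s => // x0 s s_uniq; apply: (@eq_from_nth _ 0%N).
  by rewrite size_map size_iota.
move=> i; rewrite size_map => lt_i.
by rewrite (nth_map x0) // nth_iota // index_uniq.
Qed.

Lemma count_divn_iota (c m r : nat) :
  (c < m)%N -> count (fun n => (n %/ r)%N == c) (iota 0 (m * r)) = r.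
Proof.
have [->|r_gt0] := posnP r; first by rewrite muln0.
move=> lt_cm; have -> : (m * r = c * r + (r + (m - c.+1) * r))%N by nia.
rewrite !iotaD !count_cat add0n.
rewrite (@eq_in_count _ _ pred0 (iota 0 _)) => [|n]; last first.
  rewrite mem_iota add0n /= => lt_n.
  by rewrite ltn_eqF // ltn_divLR.
rewrite (@eq_in_count _ _ predT (iota _ r)) => [|n]; last first.
  rewrite mem_iota /= => /andP[le_n lt_n].
  by rewrite eqn_leq leq_divRL // le_n -ltnS ltn_divLR // mulSn addnC lt_n.
rewrite (@eq_in_count _ _ pred0 (iota _ ((m - c.+1) * r))) => [|n]; last first.
  rewrite mem_iota /= => /andP[le_n _].
  by rewrite gtn_eqF // leq_divRL // mulSn addnC.
by rewrite !count_pred0 count_predT size_iota addn0.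
Qed.

(* Listing x and y first gives them small ranks inside their blocks, so both
   get the value 0; this needs blocks carrying each value at least twice. *)
Lemma balanced_exists (p r : nat) (I : finType) (T : eqType) (g : I -> T)
    (P : pred T) (x y : I) :
  prime p -> (1 < r)%N -> x != y ->
  (forall v, P v -> #|[set i | g i == v]| = (p * r)%N) ->
  exists z : I -> 'F_p, [/\ z x = 0, z y = 0 &
    forall v c, P v -> #|[set i | (g i == v) && (z i == c)]| = r].
Proof.
move=> p_prime r_gt1 ne_xy blocks.
pose e := [:: x, y & [seq i <- enum I | (i != x) && (i != y)]].
have e_uniq : uniq e.
  by rewrite /= !inE !mem_filter !eqxx /= andbF negb_or ne_xy filter_uniq ?enum_uniq.
have e_all i : i \in e.
  by rewrite !inE mem_filter mem_enum /= andbT; do 2!case: (i == _).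
have countE (Q : pred I) : #|[set i | Q i]| = count Q e.
  rewrite cardE -size_filter; apply/perm_size/uniq_perm.
  - exact: enum_uniq.
  - exact: filter_uniq.
  by move=> i; rewrite mem_enum mem_filter inE e_all andbT.
pose rank i := index i [seq j <- e | g j == g i].
(* A block of p r elements is cut into p consecutive runs of length r, one for each value. *)
exists (fun i => (rank i %/ r)%N%:R); split.
- by rewrite /rank /= eqxx /= eqxx div0n.
(* The rank of [y] in its block is 1 or 0, according as [x] lies in the same block or not. *)
- rewrite /rank /= eqxx; case: eqP => _ /=; rewrite ?(negPf ne_xy) eqxx ?div0n //.
  by rewrite divn_small.
move=> v c Pv; rewrite countE.
set s := [seq i <- e | g i == v].
have s_size : size s = (p * r)%N by rewrite size_filter -countE blocks.
have lt_c : (c < p)%N by rewrite -[X in (_ < X)%N](Fp_cast p_prime) ltn_ord.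
rewrite -[RHS](count_divn_iota r lt_c) -s_size -map_index ?filter_uniq //.
rewrite count_map /s count_filter; apply: eq_in_count => i _ /=.
have [gi_v|_] := eqVneq (g i) v; rewrite ?andbF //= andbT /rank gi_v -/s.
have i_s : i \in s by rewrite mem_filter gi_v eqxx e_all.
have lt_i : (index i s %/ r < p)%N.
  by rewrite ltn_divLR ?(ltnW r_gt1) // -s_size index_mem.
by rewrite -val_eqE /= val_Fp_nat // modn_small.
Qed.

(** * The order attached to a basis *)

Definition ltcoord (p : nat) (c c' : fsseq p) : Prop :=
  exists N : nat, ((c`_N)%R < (c'`_N)%R)%N /\
    forall i : nat, (N < i)%N -> c`_i = c'`_i.

Lemma Fp_neq0_gt0 (p : nat) (a : 'F_p) : (a != 0) = (0 < a)%N.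
Proof. by rewrite lt0n -val_eqE. Qed.

Lemma Fp_one_le (p : nat) (a : 'F_p) : a != 0 -> ((1 : 'F_p)%R <= a)%N.
Proof. by rewrite Fp_neq0_gt0. Qed.

(** Reading the coordinates as base-[p] digits maps the order into that of [nat], which provides
    minima of infinite sets. *)
Definition coord_code (p : nat) (c : fsseq p) : nat :=
  (\sum_(i < size c) (c`_i)%R * p ^ i)%N.

Lemma coord_code_widen (p n : nat) (c : fsseq p) :
  (size c <= n)%N -> coord_code c = (\sum_(i < n) (c`_i)%R * p ^ i)%N.
Proof.
move=> le_n; rewrite /coord_code (big_ord_widen n (fun i => (c`_i)%R * p ^ i)%N) //.
rewrite big_mkcond; apply: eq_bigr => i _; case: ltnP => // le_i.
by rewrite nth_default // mul0n.
Qed.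

Lemma digits_lt (p n : nat) (f : nat -> nat) :
  (forall i, f i < p)%N -> (\sum_(i < n) f i * p ^ i < p ^ n)%N.
Proof.
move=> f_lt; elim: n => [|n IHn]; first by rewrite big_ord0.
rewrite big_ord_recr /= expnS (leq_trans _ (leq_mul (f_lt n) (leqnn _))) //.
by rewrite mulSn ltn_add2r.
Qed.

(** The digit at [N] grows by at least one, which outweighs any loss in the digits below [N]. *)
Lemma ltcoord_code (p : nat) (c c' : fsseq p) :
  prime p -> ltcoord c c' -> (coord_code c < coord_code c')%N.
Proof.
move=> p_prime [N [ltN eqN]].
have Fp_lt (a : 'F_p) : (a < p)%N.
  by rewrite -[X in (_ < X)%N](Fp_cast p_prime) ltn_ord.
pose n := (maxn N.+1 (maxn (size c) (size c'))).
have lt_Nn : (N < n)%N by rewrite leq_max leqnn.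
rewrite !(@coord_code_widen p n); last 2 first.
- by rewrite !leq_max leqnn !orbT.
- by rewrite !leq_max leqnn !orbT.
rewrite -(big_mkord xpredT (fun i => (c`_i)%R * p ^ i)%N).
rewrite -(big_mkord xpredT (fun i => (c'`_i)%R * p ^ i)%N).
rewrite (big_cat_nat _ (n := N.+1)) // [X in (_ < X)%N](big_cat_nat _ (n := N.+1)) //=.
have -> : (\sum_(N.+1 <= i < n) (c`_i)%R * p ^ i =
    \sum_(N.+1 <= i < n) (c'`_i)%R * p ^ i)%N.
  by rewrite !big_nat; apply: eq_bigr => i /andP[lt_i _]; rewrite eqN.
rewrite ltn_add2r !big_nat_recr //= !big_mkord.
have low := @digits_lt p N (fun i => (c`_i)%R) (fun i => Fp_lt _).
have := leq_mul ltN (leqnn (p ^ N)); rewrite mulSn.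
move: low; set u := (\sum_(i < N) _)%N; set v := (\sum_(i < N) _)%N.
by move: ((c`_N)%R * _)%N ((c'`_N)%R * _)%N; lia.
Qed.

(** The deciding index is the degree of [c - c']. *)
Lemma ltcoord_total (p : nat) (c c' : fsseq p) :
  c <> c' -> ltcoord c c' \/ ltcoord c' c.
Proof.
move=> ne_cc'; have D_neq0 : c - c' != 0 by rewrite subr_eq0; apply/eqP.
pose N := (size (c - c')%R).-1.
have : (c - c')`_N != 0 by rewrite -lead_coefE lead_coef_eq0.
rewrite coefB subr_eq0 => neN.
have eqN i : (N < i)%N -> c`_i = c'`_i.
  move=> lt_Ni; apply/eqP; rewrite -subr_eq0 -coefB nth_default //.
  by apply: leq_trans lt_Ni; rewrite leqSpred.
case: (ltngtP (c`_N)%R (c'`_N)%R) => [lt|lt|eq]; [left|right|].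
- by exists N.
- by exists N; split=> // i /eqN.
- by case/eqP: neN; apply: val_inj.
Qed.

Lemma ltcoord_min (p : nat) (P : fsseq p -> Prop) (f : fsseq p -> fsseq p) :
  prime p -> injective f -> (exists x, P x) ->
  exists x, P x /\ forall y, P y -> y <> x -> ltcoord (f x) (f y).
Proof.
move=> p_prime f_inj [x0 Px0].
have ex_n : exists n, `[< exists2 x, P x & coord_code (f x) = n >].
  by exists (coord_code (f x0)); apply/asboolP; exists x0.
case: (ex_minnP ex_n) => n /asboolP[x Px xn] n_min.
exists x; split=> // y Py ne_yx.
case: (@ltcoord_total p (f x) (f y)) => [/f_inj /esym //|//|].
move=> /(ltcoord_code p_prime); rewrite ltnNge xn => /negP[]; apply: n_min.
by apply/asboolP; exists y.
Qed.

(* b = false encodes the basis E, b = true the basis F(xi, eta). *)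
Definition basisB (p : nat) (b : bool) (xi eta : nat) : nat -> fsseq p :=
  fun i => 'X^i + (b && (i == xi))%:R *: 'X^eta.

Lemma scrF_basisB (p : nat) (F : nat -> fsseq p) :
  scrF F -> exists b xi eta, xi <> eta /\ F = basisB p b xi eta.
Proof.
case=> [->|[xi [eta [ne_xe ->]]]].
  exists false, 0%N, 1%N; split=> //; apply/funext => i.
  by rewrite /basisB /= scale0r addr0.
exists true, xi, eta; split=> //; apply/funext => i; rewrite /basisB /basisF /=.
by case: eqP => [->|_]; rewrite ?scale1r // scale0r addr0.
Qed.

(** The coordinates of [x] in [basisB]: as f_xi = e_xi + e_eta, only the one at [eta] differs from
    the standard coordinate. *)
Definition bcoord (p : nat) (b : bool) (xi eta : nat) (x : fsseq p) : fsseq p :=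
  x - (b%:R * x`_xi) *: 'X^eta.

Lemma coef_bcoord (p : nat) (b : bool) (xi eta : nat) (x : fsseq p) (i : nat) :
  (bcoord b xi eta x)`_i = x`_i - (b && (i == eta))%:R * x`_xi.
Proof.
rewrite coefB coefZ coefXn; case: b => /=; last by rewrite !mul0r.
by case: eqP => _; rewrite ?mulr1 ?mul1r // mulr0 mul0r.
Qed.

Lemma coef_lincombB (p : nat) (b : bool) (xi eta : nat) (c : fsseq p) (i : nat) :
  (lincomb (basisB p b xi eta) c)`_i = c`_i + (b && (i == eta))%:R * c`_xi.
Proof.
rewrite /lincomb /basisB.
under eq_bigr do rewrite scalerDr scalerA.
rewrite big_split coefD -poly_def coef_poly; congr (_ + _).
  by case: ltnP => // le_i; rewrite nth_default.
rewrite -scaler_suml coefZ coefXn.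
have -> : \sum_(j < size c) c`_j * (b && (j == xi :> nat))%:R = b%:R * c`_xi.
  have [lt_xi|le_xi] := ltnP xi (size c).
    rewrite (bigD1 (Ordinal lt_xi)) //= eqxx andbT big1 ?addr0 1?mulrC //.
    move=> j; rewrite -val_eqE /= => /negPf->.
    by rewrite andbF mulr0.
  rewrite [c`_xi]nth_default // mulr0 big1 // => j _.
  by rewrite ltn_eqF ?andbF ?mulr0 // (leq_trans (ltn_ord j)).
case: b => /=; last by rewrite !mul0r.
by case: eqP => _; rewrite ?mulr1 ?mul1r // mulr0 mul0r.
Qed.

Lemma lincombBK (p : nat) (b : bool) (xi eta : nat) :
  xi <> eta -> cancel (lincomb (basisB p b xi eta)) (bcoord b xi eta).
Proof.
move=> /eqP ne_xe c; apply/polyP => i.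
by rewrite coef_bcoord !coef_lincombB (negPf ne_xe) andbF mul0r addr0 addrK.
Qed.

Lemma bcoordK (p : nat) (b : bool) (xi eta : nat) :
  xi <> eta -> cancel (@bcoord p b xi eta) (lincomb (basisB p b xi eta)).
Proof.
move=> /eqP ne_xe x; apply/polyP => i.
by rewrite coef_lincombB !coef_bcoord (negPf ne_xe) andbF mul0r subr0 subrK.
Qed.

Lemma ltF_basisB (p : nat) (b : bool) (xi eta : nat) (x y : fsseq p) :
  xi <> eta -> ltF (basisB p b xi eta) x y <->
    ltcoord (bcoord b xi eta x) (bcoord b xi eta y).
Proof.
move=> ne_xe; split.
  by case=> c [c' [-> -> [N ltN]]]; exists N; rewrite !lincombBK.
case=> N ltN; exists (bcoord b xi eta x), (bcoord b xi eta y).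
by split; [rewrite bcoordK| rewrite bcoordK|exists N].
Qed.

(** [xget] returns its default 0 unless a minimum exists; [ltcoord_min] provides one. *)
Lemma is_minF_xget (p : nat) (b : bool) (xi eta : nat) (P : fsseq p -> Prop) :
  prime p -> xi <> eta -> (exists x, P x) ->
  let x := xget 0 (is_minF (basisB p b xi eta) P) in
  P x /\ forall y, P y -> y <> x -> ltcoord (bcoord b xi eta x) (bcoord b xi eta y).
Proof.
move=> p_prime ne_xe exP.
have [x [Px x_min]] := ltcoord_min p_prime (can_inj (bcoordK (p := p) b ne_xe)) exP.
have /(xgetPex 0) : exists x, is_minF (basisB p b xi eta) P x.
  by exists x; split=> // y Py ne_yx; apply/ltF_basisB => //; apply: x_min.
move=> /=; set m := xget _ _; case=> Pm m_min; split=> // y Py ne_ym.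
by apply/ltF_basisB => //; apply: m_min.
Qed.

(** * Columns of the code *)

(** The chosen representatives of the one-dimensional subspaces of the span of the first [j] unit
    vectors. *)
Definition normalized (p k j : nat) (v : 'rV['F_p]_k) : bool :=
  [exists l : 'I_k, [&& (l < j)%N, v 0 l == 1 &
    [forall m : 'I_k, ((m < l) || (j <= m))%N ==> (v 0 m == 0)]]].

Lemma normalizedP (p k j : nat) (v : 'rV['F_p]_k) :
  reflect (exists l : 'I_k, [/\ (l < j)%N, v 0 l = 1,
             forall m : 'I_k, (m < l)%N -> v 0 m = 0 &
             forall m : 'I_k, (j <= m)%N -> v 0 m = 0])
          (normalized j v).
Proof.
apply: (iffP existsP) => [[l /and3P[lt_lj /eqP vl /forallP v0]]|[l [lt_lj vl v0 v1]]].
  exists l; split=> // m lt_m; apply/eqP/(implyP (v0 m)); rewrite lt_m //.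
  by rewrite orbT.
exists l; rewrite lt_lj vl eqxx; apply/forallP => m; apply/implyP.
by case/orP => [/v0->|/v1->].
Qed.

Lemma normalized_neq0 (p k j : nat) (v : 'rV['F_p]_k) : normalized j v -> v != 0.
Proof.
by case/normalizedP => l [_ vl _ _]; apply/rV0Pn; exists l; rewrite vl oner_eq0.
Qed.

(** The leading positions agree, and comparing the leading entries gives [a = 1]. *)
Lemma normalized_scale (p k j : nat) (a : 'F_p) (v v' : 'rV['F_p]_k) :
  normalized j v -> normalized j v' -> v = a *: v' -> v = v'.
Proof.
case/normalizedP => l [_ vl v0 _] /normalizedP[l' [_ vl' v0' _]] eq_v.
have a_neq0 : a != 0.
  by apply/eqP => a0; move/eqP: vl; rewrite eq_v a0 scale0r mxE eq_sym oner_eq0.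
have ll' : l = l'.
  apply/val_inj; case: (ltngtP l l') => // lt_l.
  - by move/eqP: vl; rewrite eq_v mxE v0' // mulr0 eq_sym oner_eq0.
  - by move/eqP: (v0 _ lt_l); rewrite eq_v mxE vl' mulr1 (negPf a_neq0).
by move: vl; rewrite eq_v mxE ll' vl' mulr1 => ->; rewrite scale1r.
Qed.

Lemma normalized_separated (p k j : nat) (v v' : 'rV['F_p]_k) :
  normalized j v -> normalized j v' -> v' != v ->
  exists t, dot t v = 1 /\ dot t v' = 0.
Proof.
move=> v_norm v'_norm ne_v.
case/normalizedP: (v'_norm) => l [_ v'l _ _].
(* This multiple of [v'] clears the entry of [v] at the leading position [l] of [v']; another entry
   survives, since the two vectors are not proportional. *)
have /rV0Pn[m] : v - v 0 l *: v' != 0.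
  rewrite subr_eq0; apply: contra ne_v => /eqP /(normalized_scale v_norm v'_norm) ->.
  by rewrite eqxx.
rewrite !mxE => vm_neq0; set e := _ - _ in vm_neq0.
(* The form x_m - v'_m x_l kills [v'], because v'_l = 1, and takes the value [e] at [v]. *)
exists (e^-1 *: (delta_mx 0 m + (- v' 0 m) *: delta_mx 0 l)).
rewrite !dotZ !dotD !dotZ !dot_delta v'l mulr1 subrr mulr0; split=> //.
by rewrite mulNr [v' 0 m * _]mulrC mulVf.
Qed.

(** * Distances to the span of the first words *)

Lemma hamming_widen (p n : nat) (x y : fsseq p) :
  (size x <= n)%N -> (size y <= n)%N ->
  hamming x y = #|[set i : 'I_n | x`_i != y`_i]|.
Proof.
move=> le_x le_y; rewrite /hamming -!sum_nat_of_bool.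
have le_n : (maxn (size x) (size y) <= n)%N by rewrite geq_max le_x.
rewrite (big_ord_widen n (fun i => (x`_i != y`_i)%R : nat)) // big_mkcond.
apply: eq_bigr => i _; case: ltnP => //; rewrite geq_max => /andP[le_xi le_yi].
by rewrite !nth_default // eqxx.
Qed.

Lemma hamming_subl (p : nat) (x y t : fsseq p) :
  hamming (x - t) y = hamming x (y + t).
Proof.
pose n := maxn (maxn (size x) (size y)) (size t).
have le_x : (size x <= n)%N by rewrite !leq_max leqnn.
have le_y : (size y <= n)%N by rewrite !leq_max leqnn ?orbT.
have le_t : (size t <= n)%N by rewrite !leq_max leqnn ?orbT.
rewrite !(@hamming_widen p n) //; last 2 first.
- by rewrite (leq_trans (size_polyD _ _)) // geq_max le_y.
- by rewrite (leq_trans (size_polyD _ _)) // geq_max le_x size_polyN.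
by apply: eq_card => i; rewrite !inE coefB coefD subr_eq.
Qed.

(** Truncating at [j] instead of shortening the row lets all stages use vectors of the same
    length. *)
Definition column (p k : nat) (w : nat -> fsseq p) (j i : nat) : 'rV['F_p]_k :=
  \row_l (if (l < j)%N then (w l)`_i else 0).

Definition word (p k : nat) (w : nat -> fsseq p) (j : nat) (u : 'rV['F_p]_k) :
    fsseq p :=
  \sum_(l < k | (l < j)%N) u 0 l *: w l.

Lemma coef_word (p k : nat) (w : nat -> fsseq p) (j i : nat) (u : 'rV['F_p]_k) :
  (word w j u)`_i = dot u (column k w j i).
Proof.
rewrite coef_sum big_mkcond; apply: eq_bigr => l _; rewrite coefZ mxE.
by case: ifP; rewrite ?mulr0.
Qed.

Lemma column_eq0 (p k : nat) (w : nat -> fsseq p) (j i : nat) :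
  (j <= k)%N ->
  (column k w j i == 0) = [forall l : 'I_j, (w l)`_i == 0].
Proof.
move=> le_jk; apply/eqP/forallP => [col0 l|w0].
  have := congr1 (fun v : 'rV_k => v 0 (widen_ord le_jk l)) col0.
  by rewrite !mxE /= ltn_ord => ->.
apply/rowP => l; rewrite !mxE; case: ifP => // lt_l.
by have /eqP := w0 (Ordinal lt_l).
Qed.

Lemma columnS (p k : nat) (w : nat -> fsseq p) (i : nat) (j : 'I_k) :
  column k w j.+1 i = column k w j i + (w j)`_i *: delta_mx 0 j.
Proof.
apply/rowP => l; rewrite !mxE eqxx /= ltnS leq_eqVlt (_ : (l == j :> nat) = (l == j)) //.
by case: eqP => [->|_]; rewrite ?ltnn /= ?mulr1 ?add0r // mulr0 addr0.
Qed.

Definition admis (p k : nat) (w : nat -> fsseq p) (d j : nat) (z : fsseq p) : Prop :=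
  forall u : 'rV['F_p]_k, (d <= hamming z (word w j u))%N.

(** Links sequences to the counting lemmas: any [n] beyond the supports may serve as the length. *)
Lemma hamming_word (p k n : nat) (w : nat -> fsseq p) (j : nat) (z : fsseq p)
    (u : 'rV['F_p]_k) :
  (forall l, (l < j)%N -> (size (w l) <= n)%N) -> (size z <= n)%N ->
  hamming z (word w j u) =
    disagree (fun i : 'I_n => column k w j i) (fun i => z`_i) u.
Proof.
move=> le_w le_z; rewrite (@hamming_widen p n) //.
  by apply: eq_card => i; rewrite !inE coef_word.
apply: (leq_trans (size_sum _ _ _)); apply/bigmax_leqP => l lt_l.
by rewrite (leq_trans (size_scale_leq _ _)) // le_w.
Qed.

Definition twisted (b : bool) (xi eta s : nat) : bool :=
  [&& b, (xi < s)%N & (s <= eta)%N].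

(* The words with vanishing F-coordinates from s on are those vanishing at all
   standard coordinates from s on, except when s is twisted: then the
   coordinate eta may be nonzero, but it equals the coordinate xi. *)
Record stage (p k d' : nat) (b : bool) (xi eta : nat) (w : nat -> fsseq p)
    (j s : nat) : Prop := Stage {
  stage_coord : forall l i, (l < j)%N -> (s <= i)%N ->
    (bcoord b xi eta (w l))`_i = 0;
  stage_initial : ~~ twisted b xi eta s ->
    forall i, (column k w j i != 0) = (i < s)%N;
  stage_nonadm : forall z : fsseq p,
    (forall i, (s <= i)%N -> (bcoord b xi eta z)`_i = 0) ->
    ~ admis k w (p ^ (k - 1) * d') j z;
  stage_norm : forall i, column k w j i != 0 -> normalized j (column k w j i);
  stage_block : forall n v, (forall l, (l < j)%N -> (size (w l) <= n)%N) ->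
    normalized j v ->
    #|[set i : 'I_n | column k w j i == v]| = (p ^ (k - j) * d')%N;
  stage_card : forall n, (forall l, (l < j)%N -> (size (w l) <= n)%N) ->
    (#|[set i : 'I_n | column k w j i != 0%R]| * (p - 1) =
      (p ^ j - 1) * (p ^ (k - j) * d'))%N
}.

(** Before the first word, only 0 has vanishing coordinates from 0 on, and its distance 0 to the
    sole code word is less than the required one. *)
Lemma stage0 (p k d' : nat) (b : bool) (xi eta : nat) (w : nat -> fsseq p) :
  prime p -> (0 < d')%N -> xi <> eta -> stage k d' b xi eta w 0 0.
Proof.
move=> p_prime d'_gt0 ne_xe; have p_gt0 := prime_gt0 p_prime.
have col0 i : column k w 0 i = 0 by apply/rowP => l; rewrite !mxE.
have norm0 (v : 'rV['F_p]_k) : normalized 0 v = false.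
  by apply/negbTE/negP => /normalizedP[l []].
split=> //.
- by move=> _ i; rewrite col0 eqxx.
- move=> z z0 /(_ 0); have -> : z = 0.
    apply: (can_inj (bcoordK (p := p) b ne_xe)); apply/polyP => i.
    by rewrite z0 // coef_bcoord !coef0 mulr0 subr0.
  rewrite /word big_pred0 // /hamming size_poly0.
  rewrite leqNgt (leq_ltn_trans (max_card _)) // card_ord maxnn muln_gt0.
  by rewrite expn_gt0 p_gt0.
- by move=> i; rewrite col0 eqxx.
- by move=> n v _; rewrite norm0.
move=> n _; rewrite expn0 subnn mul0n eq_card0 // => i.
by rewrite inE col0 eqxx.
Qed.

(** * From one stage to the next *)

Section Step.

Variables (p k d' : nat) (b : bool) (xi eta : nat) (w : nat -> fsseq p).
Variables (s n : nat) (j : 'I_k).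

Hypothesis p_prime : prime p.
Hypothesis d'_gt1 : (1 < d')%N.
Hypothesis ne_xe : xi <> eta.
Hypothesis st : stage k d' b xi eta w j s.
Hypothesis size_w : forall l, (l < j)%N -> (size (w l) <= n)%N.
Hypothesis lt_xi : (xi < n)%N.
Hypothesis lt_eta : (eta < n)%N.

Local Notation d := (p ^ (k - 1) * d')%N.
Local Notation r := (p ^ (k - j.+1) * d')%N.
Local Notation col := (column k w j).
Local Notation bc := (@bcoord p b xi eta).
Local Notation adm := (admis k w d j).

Let g := fun i : 'I_n => col i.

Let outside (z : fsseq p) := outer g (fun i => z`_i).

Let p_gt0 : (0 < p)%N := prime_gt0 p_prime.

Let r_gt1 : (1 < r)%N.
Proof.
have : (0 < p ^ (k - j.+1))%N by rewrite expn_gt0 p_gt0.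
by move: d'_gt1; nia.
Qed.

Let blockE : (p ^ (k - j) * d' = p * r)%N.
Proof. by rewrite mulnA -expnS subnSK. Qed.

Let dE : (p * d = p ^ j * (p * r))%N.
Proof.
rewrite -blockE !mulnA -expnS -expnD subn1 prednK ?(leq_trans _ (ltn_ord j)) //.
by rewrite subnKC // ltnW.
Qed.

(** By [stage_card], p d exceeds (p - 1) times the number of nonzero columns by exactly p r. *)
Let card_condition (o : nat) :
  (#|'F_p| * d <= #|'F_p|.-1 * #|inner g| + #|'F_p| * o)%N = (r <= o)%N.
Proof.
have := stage_card st size_w; rewrite card_Fp // -subn1 blockE.
rewrite -/(inner g) mulnC => ->; rewrite dE mulnBl mul1n.
have : (p * r <= p ^ j * (p * r))%N by rewrite leq_pmull // expn_gt0 p_gt0.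
by rewrite -[in RHS](leq_pmul2l p_gt0); move: (p * r)%N (_ * _)%N (p * o)%N; clear; lia.
Qed.

Let card_condition_eq :
  (#|'F_p| * d = #|'F_p|.-1 * #|inner g| + #|'F_p| * r)%N.
Proof.
have := stage_card st size_w; rewrite card_Fp // -subn1 blockE.
rewrite -/(inner g) mulnC => ->; rewrite dE mulnBl mul1n subnK //.
by rewrite leq_pmull // expn_gt0 p_gt0.
Qed.

Lemma card_outside_ge (z : fsseq p) :
  (size z <= n)%N -> adm z -> (r <= #|outside z|)%N.
Proof.
move=> size_z adm_z; rewrite -card_condition; apply: inner_outer_ge => u.
by rewrite -hamming_word.
Qed.

(** Supplies the comparison words for the minimality arguments: balanced on the blocks, equal to 1
    on [D] and to 0 at the other zero columns. *)
Lemma extend_word (D : pred nat) :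
  (forall i, D i -> (i < n)%N && (col i == 0%R)) ->
  (r <= #|[set i : 'I_n | D i]|)%N ->
  exists z : fsseq p,
    [/\ adm z, forall i, col i = 0 -> z`_i = (D i)%:R,
        col xi != 0 -> z`_xi = 0 & col eta != 0 -> z`_eta = 0].
Proof.
move=> D_out le_rD.
have [f [fxi feta f_bal]] : exists f : 'I_n -> 'F_p,
    [/\ f (Ordinal lt_xi) = 0, f (Ordinal lt_eta) = 0 &
     forall v c, normalized j v -> #|[set i | (g i == v) && (f i == c)]| = r].
  apply: balanced_exists => // [|v v_norm]; first by rewrite -val_eqE; apply/eqP.
  by rewrite -blockE -(stage_block st size_w v_norm).
pose F i := if col i == 0 then (D i)%:R else oapp f 0 (insub i).
have coefE i : (\poly_(i < n) F i)`_i = F i.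
  rewrite coef_poly; case: ltnP => // le_i; rewrite /F insubF /=; last first.
    by rewrite ltnNge le_i.
  case: eqP => // coli; case Di: (D i) => //.
  by have := D_out i Di; rewrite ltnNge le_i.
exists (\poly_(i < n) F i); split.
- move=> u; rewrite (@hamming_word p k n) ?size_poly //.
  apply: disagree_ge_of_balanced => [v v_neq0 c|].
    rewrite card_Fp //; case v_norm: (normalized j v).
      rewrite (stage_block st size_w v_norm) blockE -(f_bal v c v_norm) mulnC.
      congr (_ * _)%N; apply: eq_card => i; rewrite !inE coefE.
      rewrite /F; have [gi|//] := eqVneq (g i) v.
      by rewrite -/(g i) gi (negPf v_neq0) valK.
    (* Nonzero columns are normalized, so the block of any other nonzero [v] is empty. *)
    rewrite !eq_card0 ?mul0n // => i; rewrite !inE.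
    + apply/negbTE/negP => /eqP gi; move: v_norm; rewrite -gi.
      by rewrite (stage_norm st) // gi.
    + apply/negbTE/negP => /andP[/eqP gi _]; move: v_norm; rewrite -gi.
      by rewrite (stage_norm st) // gi.
  rewrite card_condition (leq_trans le_rD) // subset_leq_card //.
  apply/fintype.subsetP => i; rewrite !inE => Di.
  have /andP[_ coli] := D_out i Di.
  by rewrite /g coli coefE /F coli Di oner_eq0.
- by move=> i coli; rewrite coefE /F coli eqxx.
- by move=> /negPf coli; rewrite coefE /F coli insubT.
- by move=> /negPf coli; rewrite coefE /F coli insubT.
Qed.

(** At most [p * d] columns are nonzero, so [r] zero columns remain for the outside entries. *)
Lemma admis_exists : (p * d + r <= n)%N -> exists z : fsseq p, adm z.
Proof.
move=> le_n; case: (@extend_word (fun i => (i < n)%N && (col i == 0%R))) => //.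
  have := cardsC (inner g); rewrite card_ord.
  have -> : ~: inner g = [set i : 'I_n | (i < n)%N && (col i == 0%R)].
    by apply/setP => i; rewrite !inE negbK ltn_ord.
  suff : (#|inner g| <= p * d)%N by move: le_n; clear; lia.
  have := stage_card st size_w; rewrite -/(inner g) blockE dE mulnBl mul1n.
  have p1_gt0 : (0 < p - 1)%N by rewrite subn_gt0 prime_gt1.
  by move=> eq_card; rewrite (leq_trans (leq_pmulr _ p1_gt0)) // eq_card leq_subr.
by move=> z [adm_z _ _ _]; exists z.
Qed.

Let col_eq0P i : reflect (forall l, (l < j)%N -> (w l)`_i = 0) (col i == 0%R).
Proof.
rewrite column_eq0 ?(ltnW (ltn_ord j)) //.
apply: (iffP forallP) => [w0 l lt_l|w0 l]; last by apply/eqP/w0.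
by have /eqP := w0 (Ordinal lt_l).
Qed.

Let col_high i : (s <= i)%N -> col i != 0 -> twisted b xi eta s && (i == eta).
Proof.
move=> le_si coli; case tw: (twisted b xi eta s) => /=; last first.
  by move: coli; rewrite (stage_initial st) ?tw // ltnNge le_si.
apply: contraT => ne_ie; case/negP: coli; apply/col_eq0P => l lt_l.
have := stage_coord st lt_l le_si; rewrite coef_bcoord (negPf ne_ie).
by rewrite andbF mul0r subr0.
Qed.

(** If [s] is twisted, the words have equal entries at [xi] and [eta]; otherwise the nonzero columns
    are those below [s], and [xi] and [eta] lie on the same side of [s]. *)
Let col_twin : b -> (xi < eta)%N -> (col xi == 0) = (col eta == 0).
Proof.
move=> b_true lt_xe; case tw: (twisted b xi eta s).
  have eq_w l : (l < j)%N -> (w l)`_xi = (w l)`_eta.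
    move=> lt_l; case/and3P: tw => _ _ le_se.
    have /eqP := stage_coord st lt_l le_se.
    by rewrite coef_bcoord b_true eqxx mul1r subr_eq0 => /eqP.
  apply/col_eq0P/col_eq0P => w0 l lt_l; first by rewrite -eq_w ?w0.
  by rewrite eq_w ?w0.
apply: negb_inj; rewrite !(stage_initial st) ?tw //.
by move: tw lt_xe; rewrite /twisted b_true /=; clear; lia.
Qed.

(** * The minimal admissible word *)

Section Minimal.

Variable z : fsseq p.

Hypothesis size_z : (size z <= n)%N.
Hypothesis adm_z : adm z.
Hypothesis min_z : forall y, adm y -> y <> z -> ltcoord (bc z) (bc y).

(** The index of the highest nonzero basis coordinate of [z]. *)
Let M := (size (bc z)).-1.

Let bc_z_high i : (M < i)%N -> (bc z)`_i = 0.
Proof. by move=> lt_Mi; rewrite nth_default // (leq_trans (leqSpred _)). Qed.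

(** Otherwise [stage_nonadm] would exclude [z]. *)
Let le_sM : (s <= M)%N.
Proof.
rewrite leqNgt; apply/negP => lt_Ms; apply: (stage_nonadm st _ adm_z) => i le_si.
exact/bc_z_high/(leq_trans lt_Ms).
Qed.

Let bc_z_top : (bc z)`_M != 0.
Proof.
rewrite /M -lead_coefE lead_coef_eq0; apply/eqP => bc0.
by apply: (stage_nonadm st _ adm_z) => i _; rewrite bc0 coef0.
Qed.

Let no_low y : adm y -> (forall i, (M <= i)%N -> (bc y)`_i = 0) -> False.
Proof.
move=> adm_y y_low; have ne_yz : y <> z.
  by move=> eq_yz; move: bc_z_top; rewrite -eq_yz y_low ?eqxx.
have [N [ltN eqN]] := min_z adm_y ne_yz.
have lt_NM : (N < M)%N.
  by rewrite ltnNge; apply/negP => /y_low yN; rewrite yN in ltN.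
by move: bc_z_top; rewrite eqN // y_low ?eqxx.
Qed.

Let lt_Mn : (M < n)%N.
Proof.
rewrite ltnNge; apply/negP => le_nM; case/negP: bc_z_top.
rewrite coef_bcoord nth_default ?(leq_trans size_z) //.
by rewrite gtn_eqF ?andbF ?mul0r ?subr0 // (leq_trans lt_eta).
Qed.

(** With [r] elements in [D], [extend_word] would give an admissible word smaller than [z]. *)
Let few_low (D : pred nat) :
  (forall i, D i -> (i < n)%N && (col i == 0%R)) ->
  (forall y : fsseq p, (forall i, col i = 0 -> y`_i = (D i)%:R) ->
     (col xi != 0 -> y`_xi = 0) -> (col eta != 0 -> y`_eta = 0) ->
     forall i, (M <= i)%N -> (bc y)`_i = 0) ->
  (#|[set i : 'I_n | D i]| < r)%N.
Proof.
move=> D_out D_low; rewrite ltnNge; apply/negP => /(extend_word D_out).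
by case=> y [adm_y yD y_xi y_eta]; apply: (no_low adm_y); apply: D_low.
Qed.

Let outside_eq (D : pred nat) :
  (forall i, col i = 0 -> z`_i != 0 -> D i) ->
  (#|[set i : 'I_n | D i]| <= r)%N ->
  #|outside z| = r /\ forall i, D i -> (i < n)%N -> z`_i != 0.
Proof.
move=> zD le_Dr; have sub : outside z \subset [set i : 'I_n | D i].
  by apply/fintype.subsetP => i; rewrite !inE => /andP[/eqP]; apply: zD.
have le_r := card_outside_ge size_z adm_z.
have eq_r : #|outside z| = r.
  by apply/eqP; rewrite eqn_leq le_r andbT (leq_trans (subset_leq_card sub)).
split=> // i Di lt_i; have : Ordinal lt_i \in outside z.
  have /eqP-> : outside z == [set i : 'I_n | D i] by rewrite eqEcard sub eq_r.
  by rewrite inE.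
by rewrite inE => /andP[].
Qed.

(** Adding the top index [M] to a set bounded by [few_low] yields the bound [r] that [outside_eq]
    requires. *)
Let card_add (D D' : pred nat) (m : nat) :
  (forall i, D' i -> D i || (i == m)) ->
  (#|[set i : 'I_n | D' i]| <= #|[set i : 'I_n | D i]|.+1)%N.
Proof.
move=> sub; have [lt_m|le_m] := ltnP m n.
  apply: leq_trans (_ : #|Ordinal lt_m |: [set i : 'I_n | D i]| <= _)%N.
    apply/subset_leq_card/fintype.subsetP => i; rewrite !inE => /sub.
    by rewrite orbC -val_eqE.
  by rewrite cardsU1; case: (_ \notin _); rewrite ?leqnSn.
apply: leqW; apply/subset_leq_card/fintype.subsetP => i; rewrite !inE => /sub.
by rewrite orbC; case: eqP => // i_m; move: (ltn_ord i); rewrite i_m ltnNge le_m.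
Qed.

Let z_high i : (M < i)%N -> z`_i = (b && (i == eta))%:R * z`_xi.
Proof.
by move=> /bc_z_high; rewrite coef_bcoord => /eqP; rewrite subr_eq0 => /eqP.
Qed.

(** The common goal for all positions of [M] relative to [xi] and [eta]. The second clause prepares
    [stage_initial]; by the third, replacing outside entries by 1 makes those at [xi] and [eta]
    equal. *)
Definition minimal_support : Prop :=
  [/\ #|outside z| = r,
      ~~ twisted b xi eta M.+1 ->
        forall i, (col i != 0) || (z`_i != 0) = (i <= M)%N &
      b -> (xi < eta)%N -> col xi = 0 -> (z`_xi == 0) = (z`_eta == 0)].

(** In this range a word vanishing at the standard coordinates from [M] on has vanishing basis
    coordinates there too, so fewer than [r] zero columns lie below [M]. *)
Let support_plain : ~~ [&& b, xi <= M & M <= eta]%N -> minimal_support.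
Proof.
move=> plain.
have col_low i : col i != 0 -> (i < M)%N.
  move=> coli; case: (ltnP i s) => [lt_is|le_si]; first exact: leq_trans le_sM.
  have /andP[/and3P[b_true lt_xs le_se] /eqP ->] := col_high le_si coli.
  by move: plain le_sM lt_xs le_se; rewrite b_true /=; clear; lia.
have z0 i : (M < i)%N -> z`_i = 0.
  move=> lt_Mi; rewrite z_high //.
  case: (boolP (b && (i == eta))) => [/andP[b_true /eqP ie]|]; last by rewrite mul0r.
  rewrite z_high ?(introF eqP ne_xe) ?andbF ?mul0r ?mulr0 //.
  by move: plain lt_Mi; rewrite b_true -ie /=; clear; lia.
have lt_D : (#|[set i : 'I_n | (i < M)%N && (col i == 0%R)]| < r)%N.
  apply: (few_low (D := fun i => (i < M)%N && (col i == 0%R))).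
    by move=> i /andP[lt_iM ->]; rewrite (ltn_trans lt_iM).
  move=> y yD _ _ i le_Mi.
  have y0 m : (M <= m)%N -> y`_m = 0.
    move=> le_Mm; rewrite yD ?ltnNge ?le_Mm //.
    by apply/eqP; apply: contraLR le_Mm => /col_low; rewrite -ltnNge.
  rewrite coef_bcoord y0 // sub0r.
  case: (boolP (b && (i == eta))) => [/andP[b_true /eqP ie]|]; last by rewrite mul0r oppr0.
  rewrite y0 ?mulr0 ?oppr0 //.
  by move: plain; rewrite b_true -ie le_Mi andbT /=; clear; lia.
case: (@outside_eq (fun i => (i <= M)%N && (col i == 0%R))).
- move=> i -> zi; rewrite eqxx andbT leqNgt; apply: contra zi => /z0 ->.
  by rewrite eqxx.
- apply: leq_trans lt_D.
  apply: (@card_add (fun i => (i < M)%N && (col i == 0%R))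
    (fun i => (i <= M)%N && (col i == 0%R)) M) => i.
  by rewrite leq_eqVlt => /andP[/orP[->|->] ->]; rewrite ?orbT.
move=> eq_r D_nz; have full i : (col i != 0) || (z`_i != 0) = (i <= M)%N.
  case: (leqP i M) => [le_iM|lt_Mi].
    case: eqP => //= coli; apply: D_nz; first by rewrite le_iM coli eqxx.
    exact: leq_ltn_trans lt_Mn.
  rewrite z0 // eqxx orbF; apply/negbTE; apply: contraL lt_Mi => /col_low.
  by rewrite -leqNgt => /ltnW.
split=> // b_true lt_xe col_xi.
have col_eta : col eta == 0 by rewrite -col_twin ?col_xi ?eqxx.
apply: negb_inj.
have := full xi; have := full eta; rewrite (eqP col_eta) col_xi eqxx /= => -> ->.
by move: plain lt_xe; rewrite b_true /=; clear; lia.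
Qed.

Let support_twin : b -> (xi < eta)%N -> (M < eta)%N ->
  (z`_xi == 0) = (z`_eta == 0).
Proof.
by move=> b_true lt_xe lt_Me; rewrite (z_high lt_Me) b_true eqxx mul1r.
Qed.

(** Otherwise a word equal to 1 on all zero columns up to [eta] could be chosen with equal entries
    at [xi] and [eta], so with basis coordinate 0 at [M]. By [few_low] there are fewer than [r] such
    columns, yet they contain the outside support of [z]. *)
Let top_neq_eta : b -> (xi < eta)%N -> M <> eta.
Proof.
move=> b_true lt_xe M_eta.
have col_low i : col i != 0 -> (i <= eta)%N.
  move=> coli; case: (ltnP i s) => [lt_is|le_si].
    by rewrite -M_eta ltnW // (leq_trans lt_is).
  by have /andP[_ /eqP->] := col_high le_si coli.
have z0 i : (eta < i)%N -> z`_i = 0.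
  by move=> lt_ei; rewrite z_high ?M_eta // gtn_eqF // andbF mul0r.
suff : (#|[set i : 'I_n | (i <= eta)%N && (col i == 0%R)]| < r)%N.
  rewrite ltnNge (leq_trans (card_outside_ge size_z adm_z)) //.
  apply/subset_leq_card/fintype.subsetP => i; rewrite !inE => /andP[-> zi].
  by rewrite andbT leqNgt; apply: contra zi => /z0 ->.
apply: (few_low (D := fun i => (i <= eta)%N && (col i == 0%R))).
  by move=> i /andP[le_ie ->]; rewrite (leq_ltn_trans le_ie).
move=> y yD y_xi y_eta i; rewrite M_eta leq_eqVlt coef_bcoord.
case/orP => [/eqP <-|lt_ei]; last first.
  rewrite gtn_eqF // andbF mul0r subr0 yD 1?leqNgt ?lt_ei //.
  by apply/eqP; apply: contraLR lt_ei => /col_low; rewrite -leqNgt.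
rewrite b_true eqxx mul1r; case: (eqVneq (col xi) 0) => [col_xi|col_xi].
  have /eqP col_eta : col eta == 0 by rewrite -col_twin ?col_xi ?eqxx.
  by rewrite !yD // col_xi col_eta !eqxx leqnn ltnW // subrr.
by rewrite y_xi // y_eta ?subr0 // -col_twin.
Qed.

(** Here [eta] joins the indices below [M]: if the entries at [xi] and [eta] are equal, the basis
    coordinate at [eta] still vanishes. The next threshold [M.+1] is twisted. *)
Let support_between : b -> (xi < M < eta)%N -> minimal_support.
Proof.
move=> b_true /andP[lt_xM lt_Me]; have lt_xe := ltn_trans lt_xM lt_Me.
have col_low i : col i != 0 -> (M <= i)%N -> i = eta.
  move=> coli le_Mi; have le_si := leq_trans le_sM le_Mi.
  by have /andP[_ /eqP] := col_high le_si coli.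
have lt_D : (#|[set i : 'I_n | ((i < M) || (i == eta :> nat))%N && (col i == 0%R)]| < r)%N.
  apply: (few_low (D := fun i => ((i < M) || (i == eta))%N && (col i == 0%R))).
    by move=> i /andP[/orP[lt_iM|/eqP->] ->]; rewrite ?lt_eta // (ltn_trans lt_iM).
  move=> y yD y_xi y_eta i le_Mi; rewrite coef_bcoord b_true /=.
  case: (eqVneq i eta) => [->|ne_ie]; last first.
    rewrite mul0r subr0 yD ?ltnNge ?le_Mi ?(negPf ne_ie) //.
    by apply/eqP; apply: contra_neqT ne_ie => /col_low ->.
  rewrite mul1r; case: (eqVneq (col xi) 0) => [col_xi|col_xi].
    have /eqP col_eta : col eta == 0 by rewrite -col_twin ?col_xi ?eqxx.
    by rewrite !yD // col_xi col_eta !eqxx lt_xM orbT subrr.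
  by rewrite y_xi // y_eta ?subr0 // -col_twin.
case: (@outside_eq (fun i => ((i <= M) || (i == eta))%N && (col i == 0%R))).
- move=> i -> zi; rewrite eqxx andbT; apply: contraR zi.
  rewrite negb_or -ltnNge => /andP[lt_Mi ne_ie].
  by rewrite z_high // (negPf ne_ie) andbF mul0r.
- apply: leq_trans lt_D.
  apply: (@card_add (fun i => ((i < M) || (i == eta))%N && (col i == 0%R))
    (fun i => ((i <= M) || (i == eta))%N && (col i == 0%R)) M) => i.
  rewrite leq_eqVlt -orbA => /andP[/or3P[->|->|->] ->]; by rewrite ?orbT.
move=> eq_r _; split=> //; last by move=> *; apply: support_twin.
by rewrite /twisted b_true lt_Me (leq_trans lt_xM) // leqW.
Qed.

(* Here counting only gives r + 1 outside coordinates at most; if there were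
   r + 1, erasing the coordinate xi - 1 would give a smaller admissible word. *)
Let support_bottom : b -> M = xi -> (xi < eta)%N -> minimal_support.
Proof.
move=> b_true M_xi lt_xe.
have colE i : (col i != 0) = (i < s)%N.
  by apply: (stage_initial st); rewrite /twisted b_true -M_xi /= ltnNge le_sM.
have col0 i : (xi <= i)%N -> col i = 0.
  move=> le_xi; apply/eqP; rewrite -[col _ == _]negbK colE -leqNgt.
  by rewrite (leq_trans le_sM) // M_xi.
have lt_D : (#|[set i : 'I_n | (i < xi)%N && (col i == 0%R)]| < r)%N.
  apply: (few_low (D := fun i => (i < xi)%N && (col i == 0%R))).
    by move=> i /andP[lt_ix ->]; rewrite (ltn_trans lt_ix).
  rewrite M_xi => y yD _ _ i le_xi; rewrite coef_bcoord !yD ?col0 //.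
  by rewrite !ltnNge le_xi leqnn mulr0 subr0.
have zD i : col i = 0 -> z`_i != 0 -> ((i <= xi) || (i == eta))%N && (col i == 0%R).
  move=> -> zi; rewrite eqxx andbT; apply: contraR zi.
  rewrite negb_or -ltnNge -M_xi => /andP[lt_Mi ne_ie].
  by rewrite z_high // (negPf ne_ie) andbF mul0r.
have le_out : (#|outside z| <= r)%N.
  rewrite leqNgt; apply/negP => lt_r.
  pose D' i := ((i <= xi) || (i == eta))%N && (col i == 0%R).
  have sub : outside z \subset [set i : 'I_n | D' i].
    by apply/fintype.subsetP => i; rewrite !inE => /andP[/eqP]; apply: zD.
  pose D1 i := (i <= xi)%N && (col i == 0%R).
  have le_D' : (#|[set i : 'I_n | D' i]| <= #|[set i : 'I_n | D1 i]|.+1)%N.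
    apply: (@card_add D1 D' eta) => i /andP[/orP[le_ix|->] coli]; last by rewrite orbT.
    by rewrite /D1 le_ix coli.
  have le_D1 : (#|[set i : 'I_n | D1 i]| <=
      #|[set i : 'I_n | (i < xi)%N && (col i == 0%R)]|.+1)%N.
    apply: (@card_add (fun i => (i < xi)%N && (col i == 0%R)) D1 xi) => i.
    by rewrite /D1 leq_eqVlt => /andP[/orP[->|->] ->]; rewrite ?orbT.
  (* As [r] is at least 2, the count leaves a zero column below [xi], and zero columns start at
     [s]. *)
  have lt_sx : (s < xi)%N.
    have /card_gt0P[i] : (0 < #|[set i : 'I_n | (i < xi)%N && (col i == 0%R)]|)%N.
      by move: (subset_leq_card sub) r_gt1 lt_r le_D' le_D1 lt_D; clear; lia.
    rewrite inE => /andP[lt_ix]; rewrite -[col _ == _]negbK colE -leqNgt => le_si.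
    exact: leq_ltn_trans lt_ix.
  (* All of [D'] is needed to reach r + 1 outside coordinates, and the zero column at xi - 1 belongs
     to it. *)
  have z_pred : z`_xi.-1 != 0.
    have lt_pn : (xi.-1 < n)%N by rewrite (leq_ltn_trans (leq_pred _)).
    have : Ordinal lt_pn \in outside z.
      have /eqP-> : outside z == [set i : 'I_n | D' i].
        rewrite eqEcard sub (leq_trans le_D') // (leq_trans _ lt_r) // ltnS.
        exact: leq_trans lt_D.
      rewrite inE /D' /= leq_pred -[col _ == _]negbK colE -leqNgt.
      by move: lt_sx; clear; lia.
    by rewrite inE => /andP[].
  (* At least [r] elements remain, enough for [extend_word]. *)
  pose E i := D' i && (i != xi.-1).
  have [||y [adm_y yE _ _]] := @extend_word E.
  - move=> i /andP[/andP[/orP[le_ix|/eqP->] ->] _]; rewrite ?lt_eta //.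
    by rewrite (leq_ltn_trans le_ix).
  - have : (#|[set i : 'I_n | D' i]| <= #|[set i : 'I_n | E i]|.+1)%N.
      apply: (@card_add E D' xi.-1) => i D'i; rewrite /E D'i /=.
      by case: eqP.
    by move: (subset_leq_card sub) lt_r; clear; lia.
  have y_pred : y`_xi.-1 = 0.
    rewrite yE /E ?eqxx ?andbF //; apply/eqP; rewrite -[col _ == _]negbK colE -leqNgt.
    by move: lt_sx; clear; lia.
  have y_xi : y`_xi = 1.
    by rewrite yE ?col0 // /E /D' leqnn col0 // eqxx /= gtn_eqF // ltn_predL (leq_trans _ lt_sx).
  have y_eta : y`_eta = 1.
    rewrite yE ?col0 ?(ltnW lt_xe) // /E /D' col0 ?(ltnW lt_xe) // !eqxx orbT /=.
    by rewrite gtn_eqF // (leq_ltn_trans (leq_pred _)).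
  have y_high i : (xi < i)%N -> (bc y)`_i = 0.
    move=> lt_xi'; rewrite coef_bcoord b_true /=.
    case: (eqVneq i eta) => [->|ne_ie]; first by rewrite mul1r y_xi y_eta subrr.
    rewrite mul0r subr0 yE ?col0 ?(ltnW lt_xi') // /E /D' leqNgt lt_xi'.
    by rewrite (negPf ne_ie).
  have bc_low (x : fsseq p) i : (i <= xi)%N -> (bc x)`_i = x`_i.
    move=> le_ix; rewrite coef_bcoord ltn_eqF ?(leq_ltn_trans le_ix) //.
    by rewrite andbF mul0r subr0.
  have ne_yz : y <> z by move=> eq_yz; rewrite -eq_yz y_pred eqxx in z_pred.
  have [N [ltN eqN]] := min_z adm_y ne_yz.
  have le_Nx : (N <= xi)%N.
    by rewrite leqNgt; apply/negP => /y_high yN; rewrite yN in ltN.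
  (* At [xi] the new word is 1 and [z] is nonzero; at xi - 1 the new word is 0 and [z] is not. So
     the new word is smaller. *)
  move: ltN; rewrite !bc_low //; have [->|ne_Nx] := eqVneq N xi.
    rewrite y_xi; have : z`_xi != 0 by have := bc_z_top; rewrite M_xi bc_low.
    by move/Fp_one_le; rewrite leqNgt => /negPf->.
  have [->|ne_Np] := eqVneq N xi.-1; first by rewrite y_pred.
  have lt_Np : (N < xi.-1)%N by move: ne_Nx ne_Np le_Nx; clear; lia.
  by move: z_pred; rewrite -bc_low ?leq_pred // eqN // bc_low ?leq_pred // y_pred eqxx.
have eq_r : #|outside z| = r.
  by apply/eqP; rewrite eqn_leq le_out card_outside_ge.
split=> //; last by move=> *; apply: support_twin; rewrite ?M_xi.
by rewrite /twisted b_true M_xi ltnS leqnn lt_xe.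
Qed.

Lemma minimal_supportP : minimal_support.
Proof.
have [/and3P[b_true le_xM le_Me]|] := boolP [&& b, xi <= M & M <= eta]%N; last first.
  exact: support_plain.
have lt_xe : (xi < eta)%N by rewrite ltn_neqAle (leq_trans le_xM) // andbT; apply/eqP.
have lt_Me : (M < eta)%N.
  by rewrite ltn_neqAle le_Me andbT; apply/eqP/top_neq_eta.
case: (eqVneq M xi) => [M_xi|ne_Mx]; first exact: support_bottom.
by apply: support_between => //; rewrite lt_Me andbT ltn_neqAle eq_sym ne_Mx.
Qed.

(* Replacing the outside coordinates of z by 1 never gives a larger word. *)
Lemma outside_one i : col i = 0 -> z`_i != 0 -> z`_i = 1.
Proof.
have [_ plain twin] := minimal_supportP.
pose F m := if col m == 0 then (z`_m != 0)%:R else z`_m.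
have coefE m : (\poly_(i < n) F i)`_m = F m.
  rewrite coef_poly; case: ltnP => // le_m; rewrite /F nth_default ?eqxx ?if_same //.
  exact: leq_trans le_m.
set y := \poly_(_ < _) _ in coefE.
(* At a zero column every code word is 0, so only whether the entry is nonzero matters. *)
have adm_y : adm y.
  move=> u; rewrite (@hamming_word p k n) ?size_poly //.
  have := adm_z u; rewrite (@hamming_word p k n) //.
  suff -> : disagree g (fun i : 'I_n => z`_i) u = disagree g (fun i : 'I_n => y`_i) u by [].
  apply: eq_card => m; rewrite !inE coefE /F /g.
  have [->|//] := eqVneq (col m) 0; rewrite dot0r.
  by case: (z`_m != 0); rewrite ?eqxx ?oner_eq0.
suff <- : y = z.
  by move=> coli; rewrite coefE /F coli eqxx; case: (z`_i != 0) => //; rewrite eqxx.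
apply: contrapT => ne_yz; have [N [ltN eqN]] := min_z adm_y ne_yz.
have le_F m : ((F m)%R <= (z`_m)%R)%N.
  rewrite /F; case: ifP => // _; case: eqP => [-> //|/eqP].
  exact: Fp_one_le.
move: ltN; rewrite !coef_bcoord !coefE.
(* Only at [eta] does a basis coordinate involve two entries; elsewhere [le_F] decides. *)
case: (boolP (b && (N == eta))) => [/andP[b_true /eqP N_eta]|]; last first.
  by rewrite !mul0r !subr0 ltnNge le_F.
rewrite !mul1r N_eta; case: (ltngtP xi eta) => // [lt_xe|lt_ex].
  have [col_xi|col_xi] := eqVneq (col xi) 0.
    rewrite /F -col_twin // col_xi eqxx (twin b_true lt_xe col_xi) subrr.
    by rewrite ltn0.
  by rewrite /F -col_twin // (negPf col_xi) ltnn.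
(* As [N = eta] lies below [xi], both words agree at [xi]; if that column is zero, the entry of [z]
   there is already 0 or 1. *)
have Fxi : F xi = z`_xi.
  have := eqN xi; rewrite N_eta lt_ex => /(_ isT).
  by rewrite !coef_bcoord coefE gtn_eqF // andbF !mul0r !subr0.
rewrite Fxi; have [col_eta|col_eta] := eqVneq (col eta) 0; last first.
  by rewrite /F (negPf col_eta) ltnn.
have colE m : (col m != 0) = (m < s)%N.
  by apply: (stage_initial st); rewrite /twisted b_true; move: lt_ex; clear; lia.
have col_xi : col xi == 0.
  rewrite -[col _ == _]negbK colE; have := colE eta; rewrite col_eta eqxx.
  by move/esym/negbT; rewrite -!leqNgt => /leq_trans; apply; apply: ltnW.
have := le_F eta; move: Fxi; rewrite /F col_xi col_eta eqxx.
case: (eqVneq z`_xi 0) => [-> _ le_eta|_ <- _].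
  by rewrite !subr0 ltnNge le_eta.
case: (eqVneq z`_eta 0) => [->|_]; first by rewrite ltnn.
by rewrite [1 - 1]subrr ltn0.
Qed.

(** Exactly [r] outside coordinates make the averaging bound tight, so all distances equal [d] and
    the p values share the block of size p r equally. *)
Lemma balanced_minimal v (c : 'F_p) : normalized j v ->
  #|[set i : 'I_n | (col i == v) && (z`_i == c)]| = r.
Proof.
have [eq_r _ _] := minimal_supportP.
have dis u : disagree g (fun i : 'I_n => z`_i) u = d.
  apply: disagree_const => [u'|]; first by rewrite -hamming_word.
  by rewrite -/(outside z) eq_r card_condition_eq.
move=> v_norm.
have eqc e e' : #|[set i : 'I_n | (col i == v) && (z`_i == e)]| =
    #|[set i : 'I_n | (col i == v) && (z`_i == e')]|.
  apply: (balanced_of_disagree_const (d := d) (g := g)) => //.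
    exact: normalized_neq0 v_norm.
  by move=> i /(stage_norm st) gi_norm; apply: normalized_separated v_norm gi_norm.
have : (\sum_(e : 'F_p) #|[set i : 'I_n | (col i == v) && (z`_i == e)%R]| = p * r)%N.
  rewrite -blockE -(stage_block st size_w v_norm) -[RHS]sum1_card.
  rewrite (partition_big (fun i : 'I_n => z`_i) predT) //=.
  by apply: eq_bigr => e _; rewrite -sum1_card; apply: eq_bigl => i; rewrite !inE.
under eq_bigr => e _ do rewrite (eqc e c).
by rewrite sum_nat_const card_Fp // => /eqP; rewrite eqn_pmul2l // => /eqP.
Qed.

(** * The code after adjoining the minimal word *)

Hypothesis wj : w j = z.

Let colS i : column k w j.+1 i = col i + z`_i *: delta_mx 0 j.
Proof. by rewrite columnS wj. Qed.

Let colS_j i : column k w j.+1 i 0 j = z`_i.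
Proof. by rewrite mxE ltnSn wj. Qed.

Let colS_eq0 i : (column k w j.+1 i == 0) = (col i == 0) && (z`_i == 0).
Proof.
apply/eqP/andP => [col0|[/eqP coli /eqP zi]]; last first.
  by rewrite colS coli zi scale0r addr0.
have zi : z`_i = 0 by rewrite -colS_j col0 mxE.
by rewrite -col0 colS zi scale0r addr0 !eqxx.
Qed.

(** Distances are translation invariant, and adding [c *: z] to an old code word gives a new one. *)
Let admis_shift y (c : 'F_p) : admis k w d j.+1 y -> adm (y - c *: z).
Proof.
move=> adm_y u; rewrite hamming_subl.
pose u' : 'rV['F_p]_k := \row_l (if l == j then c else u 0 l).
suff <- : word w j.+1 u' = word w j u + c *: z by apply: adm_y.
apply/polyP => i; rewrite coefD coefZ !coef_word colS.
rewrite /dot (bigD1 j) //= [in RHS](bigD1 j) //= !mxE !eqxx ltnn.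
rewrite mulr0 !add0r mulr1 addrC; congr (_ + _); apply: eq_bigr => l ne_lj.
by rewrite !mxE (negPf ne_lj) andbF mulr0 addr0.
Qed.

Let size_wS l : (l < j.+1)%N -> (size (w l) <= n)%N.
Proof. by rewrite ltnS leq_eqVlt => /orP[/eqP->|/size_w //]; rewrite wj. Qed.

(** A stage speaks of every length beyond the supports, the step of one [n]; the additional columns
    are 0 and not counted by [Q]. *)
Let card_column n' (Q : pred 'rV['F_p]_k) :
  (forall l, (l < j.+1)%N -> (size (w l) <= n')%N) -> Q 0 = false ->
  #|[set i : 'I_n' | Q (column k w j.+1 i)]| =
  #|[set i : 'I_n | Q (column k w j.+1 i)]|.
Proof.
move=> size_w' Q0; have Q_lt (m : nat) i :
    (forall l, (l < j.+1)%N -> (size (w l) <= m)%N) -> Q (column k w j.+1 i) ->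
    (i < m)%N.
  move=> size_m; apply: contraLR; rewrite -leqNgt => le_mi.
  suff -> : column k w j.+1 i = 0 by rewrite Q0.
  apply/rowP => l; rewrite !mxE; case: ifP => // /size_m le_l.
  by rewrite nth_default // (leq_trans le_l).
pose N := maxn n n'.
have widen m : (m <= N)%N -> (forall l, (l < j.+1)%N -> (size (w l) <= m)%N) ->
    #|[set i : 'I_m | Q (column k w j.+1 i)]| =
    (\sum_(i < N) Q (column k w j.+1 i))%N.
  move=> le_mN size_m; rewrite -sum_nat_of_bool.
  rewrite [LHS](big_ord_widen N (fun i => Q (column k w j.+1 i) : nat)) //.
  rewrite [LHS]big_mkcond; apply: eq_bigr => i _; case: ifP => // /negbT; rewrite -leqNgt => le_mi.
  case Qi: (Q _) => //; have := Q_lt m i size_m Qi.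
  by rewrite ltnNge le_mi.
by rewrite !widen // ?leq_maxl ?leq_maxr.
Qed.

Lemma stage_next : stage k d' b xi eta w j.+1 M.+1.
Proof.
have [eq_r plain twin] := minimal_supportP.
split.
- move=> l i; rewrite ltnS leq_eqVlt => /orP[/eqP->|lt_l] lt_Mi.
    by rewrite wj bc_z_high.
  by rewrite (stage_coord st) // (leq_trans le_sM) // ltnW.
- by move=> /plain full i; rewrite colS_eq0 negb_and full ltnS.
- move=> y y_low adm_y.
  (* Subtracting this multiple of [z] cancels the coordinate at [M] and leaves an admissible word
     excluded by [no_low]. *)
  pose c := (bc y)`_M / (bc z)`_M.
  apply: (no_low (admis_shift c adm_y)) => i le_Mi.
  have -> : (bc (y - c *: z))`_i = (bc y)`_i - c * (bc z)`_i.
    rewrite !coef_bcoord !coefB !coefZ mulrBr (mulrBr c) mulrCA.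
    by rewrite !opprB addrACA [RHS]addrACA; congr (_ + _); rewrite addrC.
  move: le_Mi; rewrite leq_eqVlt => /orP[/eqP<-|lt_Mi].
    by rewrite /c divfK // subrr.
  by rewrite y_low // bc_z_high // mulr0 subrr.
- move=> i; rewrite colS_eq0 negb_and => nz; apply/normalizedP.
  (* A newly nonzero column begins with the entry 1 in row [j], by [outside_one]; an old one keeps
     its leading entry. *)
  case: (eqVneq (col i) 0) nz => [coli /= zi|coli _].
    exists j; split=> //.
    + by rewrite colS_j outside_one.
    + move=> m lt_m; have ne_mj : m != j by rewrite -val_eqE /= ltn_eqF.
      by rewrite colS coli add0r !mxE (negPf ne_mj) andbF mulr0.
    + by move=> m lt_m; rewrite mxE ltnNge lt_m.
  have /normalizedP[l [lt_l coll col0 _]] := stage_norm st coli.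
  have lj (m : 'I_k) : (m < j)%N -> column k w j.+1 i 0 m = col i 0 m.
    by move=> lt_m; rewrite !mxE lt_m ltnS ltnW.
  exists l; split; first exact: ltnW.
  + by rewrite lj.
  + by move=> m lt_m; rewrite lj ?col0 // (ltn_trans lt_m).
  + by move=> m lt_m; rewrite mxE ltnNge lt_m.
- move=> n' v size_w' v_norm; rewrite (card_column (Q := pred1 v) size_w'); last first.
    by rewrite /= eq_sym (negPf (normalized_neq0 v_norm)).
  have [l [lt_l vl v_low v_high]] := normalizedP _ _ v_norm.
  (* The block of [v] is the part of the old block of [v0] where [z] has the value [v 0 j]. If [v]
     is led by row [j], then [v0] is 0 and this part is the outside support. *)
  pose v0 : 'rV['F_p]_k := \row_m (if m == j then 0 else v 0 m).
  have eq_colS i : (column k w j.+1 i == v) = (col i == v0) && (z`_i == v 0 j).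
    apply/eqP/andP => [eq_v|[/eqP coli /eqP zi]].
      split; last by rewrite -eq_v colS_j.
      apply/eqP/rowP => m; rewrite mxE [RHS]mxE -eq_v mxE ltnS.
      have [->|ne_mj] := eqVneq m j; first by rewrite ltnn.
      by move: ne_mj; rewrite -val_eqE /= ltn_neqAle => ->.
    rewrite colS coli zi; apply/rowP => m; rewrite !mxE eqxx /=.
    by case: eqVneq => [->|_]; rewrite ?mulr1 ?add0r // mulr0 addr0.
  under eq_finset => i do rewrite /= eq_colS.
  have [l_j|ne_lj] := eqVneq l j.
    have vj : v 0 j = 1 by rewrite -l_j.
    have v0E : v0 = 0.
      apply/rowP => m; rewrite !mxE; case: eqVneq => // ne_mj.
      case: (ltngtP m j) => [lt_mj|lt_jm|/val_inj eq_mj].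
      - by rewrite v_low ?l_j.
      - by rewrite v_high.
      - by rewrite eq_mj eqxx in ne_mj.
    rewrite -eq_r /outside /outer; apply: eq_card => i; rewrite !inE v0E vj.
    rewrite /g; case: eqVneq => //= coli.
    by apply/eqP/idP => [->|]; [rewrite oner_eq0 | apply: outside_one].
  apply: balanced_minimal; apply/normalizedP; exists l; rewrite !mxE (negPf ne_lj).
  have lt_lj : (l < j)%N.
    by move: ne_lj; rewrite -val_eqE /= ltn_neqAle => ->.
  split=> // m; first by move=> lt_m; rewrite mxE v_low ?if_same.
  move=> le_jm; rewrite mxE; have [//|ne_mj] := eqVneq m j; apply: v_high.
  by move: ne_mj; rewrite -val_eqE /= ltn_neqAle eq_sym => ->.
- move=> n' size_w'.
  rewrite (card_column (Q := predC1 0) size_w') /=; last by rewrite eqxx.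
  have -> : #|[set i : 'I_n | column k w j.+1 i != 0%R]| = (#|inner g| + r)%N.
    rewrite -eq_r -(cardsID (inner g)); congr (_ + _)%N; apply: eq_card => i.
      rewrite !inE colS_eq0 /g; case: (col i == 0) => //=.
      by rewrite andbF.
    by rewrite !inE colS_eq0 /g; case: (col i == 0).
  rewrite mulnDl (stage_card st size_w) blockE expnS !mulnBl !mul1n mulnBr muln1.
  rewrite mulnCA mulnA [(r * p)%N]mulnC.
  have : (p * r <= p * p ^ j * r)%N.
    by rewrite -mulnA leq_mul2l leq_pmull ?orbT // expn_gt0 p_gt0.
  have : (r <= p * r)%N by rewrite leq_pmull.
  by move: (p * r)%N (p * p ^ j * r)%N r => x y t; clear; lia.
Qed.

End Minimal.

End Step.

(** * The words and the code *)

Lemma exists_digits (p j : nat) (f : nat -> nat) :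
  (0 < p)%N -> (forall l, f l < p)%N ->
  exists2 a, (a < p ^ j)%N & forall l, (l < j)%N -> ((a %/ p ^ l) %% p)%N = f l.
Proof.
move=> p_gt0; elim: j f => [|j IHj] f f_lt; first by exists 0%N.
have [a lt_a aE] := IHj (fun l => f l.+1) (fun l => f_lt l.+1).
exists (f 0 + a * p)%N.
  by rewrite expnSr; move: (f_lt 0%N) lt_a; move: (p ^ j)%N (f 0%N) => q e; nia.
have divE : ((f 0 + a * p) %/ p = a)%N by rewrite divnDMl // divn_small.
case=> [|l] lt_l; first by rewrite expn0 divn1 addnC modnMDl modn_small.
by rewrite expnS divnMA divE aE.
Qed.

Lemma digit_pow (p i l : nat) :
  (1 < p)%N -> ((p ^ i %/ p ^ l) %% p)%N = (l == i).
Proof.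
move=> p_gt1; have p_gt0 := ltnW p_gt1; case: (ltngtP l i) => [lt_li|lt_il|->].
- by rewrite -expnB // 1?ltnW // -(prednK (n := (i - l)%N)) ?subn_gt0 // expnS modnMr.
- by rewrite divn_small ?mod0n // ltn_exp2l.
- by rewrite divnn expn_gt0 p_gt0 modn_small.
Qed.

Section Words.

Variables (p k : nat) (F : nat -> fsseq p) (d : nat).

Hypothesis p_prime : prime p.

Local Notation w := (fun l => wminus F d (p ^ l)).

Definition digit_row (a : nat) : 'rV['F_p]_k :=
  \row_l ((a %/ p ^ l) %% p)%N%:R.

(** The digit formula also holds at powers of [p], where it has a single term; hence the code is
    linear. *)
Lemma wminus_word (j a : nat) :
  (j <= k)%N -> (a < p ^ j)%N -> wminus F d a = word w j (digit_row a).
Proof.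
move=> le_jk lt_a; have p_gt1 := prime_gt1 p_prime.
have -> : word w j (digit_row a) =
    \sum_(l < j) ((a %/ p ^ l) %% p)%N%:R *: wminus F d (p ^ l).
  rewrite (big_ord_widen k (fun l => ((a %/ p ^ l) %% p)%N%:R *: wminus F d (p ^ l))) //.
  by apply: eq_bigr => l _; rewrite mxE.
have [[i a_pow]|not_pow] := EM (exists i, a = (p ^ i)%N).
  have lt_ij : (i < j)%N by rewrite a_pow ltn_exp2l in lt_a.
  rewrite a_pow (bigD1 (Ordinal lt_ij)) //= digit_pow // eqxx scale1r.
  rewrite big1 ?addr0 // => l ne_li; rewrite digit_pow //.
  by move: ne_li; rewrite -val_eqE /= => /negPf->; rewrite scale0r.
rewrite wminus_npow //.
pose f l := ((a %/ p ^ l) %% p)%N%:R *: wminus F d (p ^ l).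
(* The definition sums up to [a], the word up to [j]; both extend to [a + j], as the further digits
   are 0. *)
have widen m : (m <= a + j)%N -> (a < p ^ m)%N ->
    \sum_(l < m) f l = \sum_(l < a + j) f l.
  move=> le_m lt_am; rewrite (big_ord_widen (a + j) f) // big_mkcond.
  apply: eq_bigr => l _; case: ltnP => // le_ml.
  rewrite /f divn_small ?mod0n ?scale0r // (leq_trans lt_am) //.
  by rewrite leq_exp2l.
by rewrite -[LHS]/(\sum_(l < a) f l) -[RHS]/(\sum_(l < j) f l) !widen
  ?leq_addr ?leq_addl // ltn_expl.
Qed.

Lemma digit_row_onto (j : nat) (u : 'rV['F_p]_k) :
  exists2 a, (a < p ^ j)%N & word w j (digit_row a) = word w j u.
Proof.
have p_gt0 := prime_gt0 p_prime.
have Fp_lt (a : 'F_p) : (a < p)%N.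
  by rewrite -[X in (_ < X)%N](Fp_cast p_prime) ltn_ord.
pose f l : nat := oapp (fun m : 'I_k => u 0 m : nat) 0%N (insub l).
have [|a lt_a aE] := @exists_digits p j f p_gt0.
  by move=> l; rewrite /f; case: insubP => //= m _ _; apply: Fp_lt.
exists a => //; apply: eq_bigr => l lt_l; rewrite mxE aE // /f valK /=.
by congr (_ *: _); apply: val_inj; rewrite /= val_Fp_nat // modn_small.
Qed.

(** The words before [p ^ j] are all the combinations of the first [j] generators. *)
Lemma admis_wminus (j : nat) (z : fsseq p) :
  (j <= k)%N ->
  (forall a, (a < p ^ j)%N -> (d <= hamming z (wminus F d a))%N) <->
  admis k w d j z.
Proof.
move=> le_jk; split=> [adm u|adm a lt_a]; last by rewrite (wminus_word le_jk).
have [a lt_a <-] := digit_row_onto j u.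
by rewrite -wminus_word // adm.
Qed.

Lemma mem_LexMinus (x : fsseq p) :
  x \in LexMinus F d k <-> exists u : 'rV['F_p]_k, x = word w k u.
Proof.
split=> [/mapP[a]|[u ->]].
  rewrite mem_iota add0n /= => lt_a ->.
  by exists (digit_row a); rewrite -wminus_word.
have [a lt_a <-] := digit_row_onto k u; rewrite -wminus_word //.
by apply/mapP; exists a; rewrite // mem_iota.
Qed.

End Words.

Lemma stage_exists (p k d' : nat) (b : bool) (xi eta j : nat) :
  prime p -> (1 < d')%N -> xi <> eta -> (j <= k)%N ->
  let d := (p ^ (k - 1) * d')%N in
  exists s, stage k d' b xi eta (fun l => wminus (basisB p b xi eta) d (p ^ l)) j s.
Proof.
move=> p_prime d'_gt1 ne_xe le_jk d.
pose w l := wminus (basisB p b xi eta) d (p ^ l); rewrite -/w.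
elim: j le_jk => [_|j IHj lt_jk].
  by exists 0%N; apply: stage0 => //; apply: ltnW.
have [s st] := IHj (ltnW lt_jk).
(* Large enough to contain the supports, [xi] and [eta], and to leave the zero columns that
   [admis_exists] needs. *)
pose n := (\max_(l < j.+1) size (w l) + xi + eta + p * d +
  p ^ (k - j.+1) * d' + 1)%N.
have size_wS l : (l < j.+1)%N -> (size (w l) <= n)%N.
  move=> lt_l; rewrite /n -!addnA (leq_trans _ (leq_addr _ _)) //.
  exact: (@leq_bigmax _ (fun l : 'I_j.+1 => size (w l)) (Ordinal lt_l)).
have size_w l : (l < Ordinal lt_jk)%N -> (size (w l) <= n)%N.
  by move=> /= lt_l; apply: size_wS; apply: ltnW.
have lt_xi : (xi < n)%N by rewrite /n; lia.
have lt_eta : (eta < n)%N by rewrite /n; lia.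
have le_n : (p * d + p ^ (k - (Ordinal lt_jk).+1) * d' <= n)%N by rewrite /n /=; lia.
have := admis_exists (j := Ordinal lt_jk) p_prime d'_gt1 ne_xe st size_w lt_xi lt_eta le_n.
move=> /(@is_minF_xget p b xi eta _ p_prime ne_xe) /=.
have admE z := @admis_wminus p k (basisB p b xi eta) d p_prime j z (ltnW lt_jk).
have -> : admis k w d j =
    (fun z => forall a, (a < p ^ j)%N ->
       (d <= hamming z (wminus (basisB p b xi eta) d a))%N).
  by apply/funext => z; apply/propext; apply: iff_sym; apply: admE.
rewrite -wminus_pow -/(w j) => -[adm_w min_w].
exists (size (bcoord b xi eta (w j))).-1.+1.
apply: (@stage_next p k d' b xi eta w s n (Ordinal lt_jk) p_prime d'_gt1 ne_xe st
  size_w lt_xi lt_eta (w j)) => //=.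
- exact: size_wS.
- exact/admE.
- by move=> y adm_y; apply: min_w; apply/admE.
Qed.

(** * Simplex codes *)

Lemma card_ord_iota (n : nat) (P : pred nat) :
  #|[set i : 'I_n | P i]| = count P (iota 0 n).
Proof.
rewrite -sum1_count -[in iota 0 n](subn0 n) -/(index_iota 0 n) big_mkord.
by rewrite big_mkcond -sum_nat_of_bool; apply: eq_bigr => i _; case: (P i).
Qed.

Lemma card_divn_ord (m r c : nat) :
  (c < m)%N -> #|[set t : 'I_(m * r) | (t %/ r)%N == c]| = r.
Proof.
by move=> lt_cm; rewrite (card_ord_iota _ (fun t => (t %/ r)%N == c)) count_divn_iota.
Qed.

Lemma card_ord_nth (T : Type) (x0 : T) (s : seq T) (P : pred T) :
  #|[set t : 'I_(size s) | P (nth x0 s t)]| = count P s.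
Proof.
rewrite -sum1_count (big_nth x0) big_mkord big_mkcond -sum_nat_of_bool.
by apply: eq_bigr => t _; case: (P _).
Qed.

(** An element of a fibre of [f] is sent to the element of equal rank in the matching fibre of
    [h]. *)
Lemma fibre_bijection (I J : finType) (T : eqType) (f : I -> T) (h : J -> T) :
  J -> #|I| = #|J| ->
  (forall i, #|[set i' | f i' == f i]| = #|[set j | h j == f i]|) ->
  exists e : I -> J, bijective e /\ forall i, h (e i) = f i.
Proof.
move=> j0 card_IJ fibres.
pose A i := enum [set i' | f i' == f i].
pose B i := enum [set j | h j == f i].
pose e i := nth j0 (B i) (index i (A i)).
have A_i i : i \in A i by rewrite mem_enum inE.
have e_lt i : (index i (A i) < size (B i))%N.
  by rewrite -cardE -fibres cardE index_mem.
have he i : h (e i) = f i.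
  by have := mem_nth j0 (e_lt i); rewrite mem_enum inE => /eqP.
exists e; split=> //; apply: inj_card_bij; last by rewrite card_IJ.
move=> i i' eq_e; have eq_f : f i = f i' by rewrite -!he eq_e.
have eqA : A i' = A i by rewrite /A eq_f.
have eqB : B i' = B i by rewrite /B eq_f.
move: eq_e (e_lt i') (A_i i'); rewrite /e eqA eqB => /eqP eq_e lt_i' A_i'.
move: eq_e; rewrite nth_uniq ?enum_uniq // => /eqP eq_index.
by rewrite -(nth_index i (A_i i)) eq_index nth_index.
Qed.

Lemma dotC (F : fieldType) (k : nat) (u v : 'rV[F]_k) : dot u v = dot v u.
Proof. by apply: eq_bigr => l _; rewrite mulrC. Qed.

(** * Normalized vectors as points of projective space *)

Section Projective.

Variables (p k : nat).

Hypothesis p_prime : prime p.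

Lemma normalized_multiple (v : 'rV['F_p]_k) :
  v != 0 -> exists a v', [/\ a != 0, normalized k v' & v = a *: v'].
Proof.
case/rV0Pn => l0 vl0; pose l := [arg min_(l < l0 | v 0%R l != 0%R) l]%N.
have [vl l_min] : v 0 l != 0 /\ forall m, v 0 m != 0 -> (l <= m)%N.
  by rewrite /l; case: arg_minnP.
exists (v 0 l), ((v 0 l)^-1 *: v); split=> //; last first.
  by rewrite scalerA divff // scale1r.
apply/normalizedP; exists l; split=> //.
- by rewrite mxE mulVf.
- move=> m lt_m; rewrite mxE; have [->|/l_min] := eqVneq (v 0 m) 0.
    by rewrite mulr0.
  by rewrite leqNgt lt_m.
- by move=> m; rewrite leqNgt ltn_ord.
Qed.

(** Each nonzero vector is, in exactly one way, a nonzero scalar times a normalized vector. *)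
Lemma card_normalized_multiples (Q : pred 'rV['F_p]_k) :
  Q 0 = false -> (forall a v, a != 0 -> Q (a *: v) = Q v) ->
  #|[set v | Q v]| = ((p - 1) * #|[set v | normalized k v && Q v]|)%N.
Proof.
move=> Q0 QZ.
have <- : #|[set a : 'F_p | a != 0]| = (p - 1)%N.
  rewrite subn1 -[X in X.-1](card_Fp p_prime) -(cardsC1 0).
  by apply: eq_card => a; rewrite !inE.
rewrite -cardsX.
pose f (av : 'F_p * 'rV['F_p]_k) := av.1 *: av.2.
rewrite -(card_in_imset (f := f)) => [|[a v] [a' v']]; last first.
  rewrite !inE /f /= => /andP[a_nz /andP[v_norm _]] /andP[a'_nz /andP[v'_norm _]] eq_av.
  have eq_v : v = v'.
    apply: (normalized_scale (a := a^-1 * a') v_norm v'_norm).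
    by rewrite -scalerA -eq_av scalerA mulVf // scale1r.
  congr (_, _) => //; move: eq_av; rewrite eq_v => /eqP.
  rewrite -subr_eq0 -scalerBl scaler_eq0 (negPf (normalized_neq0 v'_norm)) orbF.
  by rewrite subr_eq0 => /eqP.
apply: eq_card => v; rewrite !inE; apply/idP/imsetP => [Qv|[[a v']]].
  have v_nz : v != 0 by apply: contraTneq Qv => ->; rewrite Q0.
  have [a [v' [a_nz v'_norm eq_v]]] := normalized_multiple v_nz.
  by exists (a, v'); rewrite ?inE //= a_nz v'_norm -(QZ a) // -eq_v.
by rewrite !inE /f /= => /andP[a_nz /andP[_ Qv']] ->; rewrite QZ.
Qed.

Lemma card_normalized :
  ((p - 1) * #|[set v : 'rV['F_p]_k | normalized k v]| = p ^ k - 1)%N.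
Proof.
transitivity #|[set v : 'rV['F_p]_k | v != 0]|.
  rewrite (card_normalized_multiples (Q := fun v => v != 0)) ?eqxx // => [|a v a_nz]; last first.
    by rewrite scaler_eq0 (negPf a_nz).
  congr (_ * _)%N; apply: eq_card => v; rewrite !inE.
  by case v_norm: (normalized k v) => //=; rewrite (normalized_neq0 v_norm).
have -> : (p ^ k - 1 = #|'rV['F_p]_k|.-1)%N by rewrite card_mx mul1n card_Fp // subn1.
by rewrite -(cardsC1 0); apply: eq_card => v; rewrite !inE.
Qed.

End Projective.

(* A repetition needs blocks of equal, and not only proportional, columns. *)
Definition uniform (p k N R : nat) (H : 'M['F_p]_(k, N)) : Prop :=
  (forall t, normalized k (col t H)^T) /\
  (forall v, normalized k v -> #|[set t | (col t H)^T == v]| = R).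

Lemma mulmx_dot (p k N : nat) (u : 'rV['F_p]_k) (H : 'M['F_p]_(k, N)) (t : 'I_N) :
  (u *m H) 0 t = dot u (col t H)^T.
Proof. by rewrite mxE; apply: eq_bigr => l _; rewrite !mxE. Qed.

(** * Codes generated by uniform matrices *)

Section Uniform.

Variables (p k N R : nat) (H : 'M['F_p]_(k, N)).

Hypothesis p_prime : prime p.
Hypothesis k_gt0 : (0 < k)%N.
Hypothesis R_gt0 : (0 < R)%N.
Hypothesis H_unif : uniform R H.

Let C := [set u *m H | u : 'rV['F_p]_k].

Lemma card_uniform (Q : pred 'rV['F_p]_k) :
  #|[set t | Q (col t H)^T]| = (R * #|[set v | normalized k v && Q v]|)%N.
Proof.
case: H_unif => H_norm H_card.
rewrite -sum1_card (partition_big (fun t => (col t H)^T)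
  (fun v => v \in [set v | normalized k v && Q v])) => [|t]; last first.
  by rewrite !inE H_norm.
rewrite mulnC -sum_nat_const; apply: eq_bigr => v; rewrite inE => /andP[v_norm Qv].
rewrite -(H_card v v_norm) -sum1_card; apply: eq_bigl => t; rewrite !inE.
by have [->|] := eqVneq (col t H)^T v; rewrite ?Qv // andbF.
Qed.

Lemma uniform_length : N = ((p ^ k - 1) %/ (p - 1) * R)%N.
Proof.
rewrite -(card_normalized k p_prime) mulKn ?subn_gt0 ?prime_gt1 //.
have := card_uniform predT; rewrite mulnC.
have -> : [set t | predT (col t H)^T] = [set: 'I_N] by apply/setP => t; rewrite !inE.
rewrite cardsT card_ord => ->; congr (_ * _)%N.
by apply: eq_card => v; rewrite !inE andbT.
Qed.

(** The normalized vectors off the hyperplane orthogonal to [u] number (p^k - p^(k-1)) / (p - 1) =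
    p^(k-1), and each is a column [R] times. *)
Lemma uniform_weight (u : 'rV['F_p]_k) :
  u != 0 -> #|[set t | (u *m H) 0 t != 0]| = (p ^ (k - 1) * R)%N.
Proof.
move=> u_nz; under eq_finset => t do rewrite mulmx_dot.
rewrite (card_uniform (fun v => dot u v != 0)) mulnC; congr (_ * _)%N.
have p1_gt0 : (0 < p - 1)%N by rewrite subn_gt0 prime_gt1.
apply/eqP; rewrite -(eqn_pmul2l p1_gt0) -(@card_normalized_multiples p k p_prime
  (fun v => dot u v != 0)) ?dot0r ?eqxx // => [|a v a_nz]; last first.
  by rewrite dotC dotZ dotC mulf_eq0 (negPf a_nz).
have pk : (p ^ k = p * p ^ (k - 1))%N by rewrite -expnS subn1 prednK.
have card_perp : #|[set v | dot v u == 0]| = (p ^ (k - 1))%N.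
  have := @card_hyperplane 'F_p k u 0 u_nz; rewrite card_Fp // pk mulnC => /eqP.
  by rewrite eqn_pmul2l ?prime_gt0 // => /eqP.
have := cardsC [set v | dot v u == 0].
have -> : ~: [set v | dot v u == 0] = [set v | dot u v != 0].
  by apply/setP => v; rewrite !inE dotC.
rewrite card_mx card_Fp // mul1n pk card_perp mulnBl mul1n => <-.
by rewrite addKn.
Qed.

Lemma uniform_row_free : row_free H.
Proof.
rewrite -kermx_eq0; apply/rowV0P => u /sub_kermxP uH0; apply/eqP.
apply: contraT => /uniform_weight; rewrite uH0 eq_card0 => [/esym/eqP|t].
  by rewrite muln_eq0 expn_eq0 !eqn0Ngt R_gt0 prime_gt0 ?orbF.
by rewrite inE mxE eqxx.
Qed.

Lemma uniform_generator : generator_matrix H C.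
Proof. by split; [exact: uniform_row_free|]. Qed.

Lemma uniform_is_code : is_code C N k (p ^ (k - 1) * R).
Proof.
split=> //; pose f : 'Hom('rV['F_p]_k, 'rV['F_p]_N) := linfun (mulmxr H).
have f_inj : lker f = 0%VS.
  apply/eqP; rewrite -subv0; apply/subvP => u; rewrite memv_ker lfunE /= memv0.
  move=> /eqP uH0; apply: contraT => /uniform_weight; rewrite uH0 eq_card0.
    by move/esym/eqP; rewrite muln_eq0 expn_eq0 !eqn0Ngt R_gt0 prime_gt0 ?orbF.
  by move=> t; rewrite inE mxE eqxx.
have distE u u' : hamming_rV (u *m H) (u' *m H) =
    #|[set t | ((u - u') *m H) 0 t != 0]|.
  apply: eq_card => t; rewrite !inE mulmxBl !mxE subr_eq0.
  by [].
exists (limg f); split.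
- move=> x; apply/imsetP/memv_imgP => [[u _ ->]|[u _ ->]].
    by exists u; rewrite ?memvf // lfunE.
  by exists u => //; rewrite lfunE.
- rewrite limg_dim_eq ?dimvf ?f_inj ?capv0 //.
  exact: mul1n.
split.
  have [t _] : exists t : 'I_k, true by exists (Ordinal k_gt0).
  pose u : 'rV['F_p]_k := delta_mx 0 t.
  have u_nz : u - 0 != 0.
    by rewrite subr0; apply/rV0Pn; exists t; rewrite mxE !eqxx oner_eq0.
  have wt : hamming_rV (u *m H) (0 *m H) = (p ^ (k - 1) * R)%N.
    by rewrite distE uniform_weight.
  exists (u *m H), (0 *m H); split=> //; try exact: imset_f.
  apply: contraTneq isT => eq_u; move/eqP: wt; rewrite eq_u /hamming_rV eq_card0.
    by rewrite eq_sym muln_eq0 expn_eq0 !eqn0Ngt R_gt0 prime_gt0 ?orbF.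
  by move=> i; rewrite inE eqxx.
move=> _ _ /imsetP[u _ ->] /imsetP[u' _ ->] ne_u.
rewrite distE uniform_weight // subr_eq0.
by apply: contraNneq ne_u => ->.
Qed.

End Uniform.

(** The columns are the normalized vectors, each listed once. *)
Lemma simplex_exists (p k n : nat) :
  prime p -> n = ((p ^ k - 1) %/ (p - 1))%N ->
  exists2 G : 'M['F_p]_(k, n), uniform 1 G & simplex_matrix G.
Proof.
move=> p_prime nE.
pose V := [set v : 'rV['F_p]_k | normalized k v].
have card_V : #|V| = n.
  by rewrite nE -(card_normalized k p_prime) mulKn // subn_gt0 prime_gt1.
pose e (j : 'I_n) := enum_val (cast_ord (esym card_V) j).
pose G := \matrix_(l < k, j < n) e j 0 l.
have colG j : (col j G)^T = e j by apply/rowP => l; rewrite !mxE.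
have e_norm j : normalized k (e j) by have := enum_valP (cast_ord (esym card_V) j); rewrite inE.
have e_inj : injective e by move=> i j /enum_val_inj /cast_ord_inj.
have e_onto v : normalized k v -> exists j, e j = v.
  move=> v_norm; have vV : v \in V by rewrite inE.
  exists (cast_ord card_V (enum_rank_in vV v)).
  by rewrite /e cast_ordK enum_rankK_in.
exists G.
  split=> [j|v v_norm]; first by rewrite colG.
  have [j0 ej0] := e_onto v v_norm; apply/eqP/cards1P.
  exists j0; apply/setP => j.
  by rewrite !inE colG -ej0 (inj_eq e_inj).
split=> [j|U dimU].
  apply/eqP => colj; have := normalized_neq0 (e_norm j).
  by rewrite -colG colj trmx0 eqxx.
have x_nz : vpick U != 0 by rewrite vpick0 -dimv_eq0 dimU.
have UE : U = <[vpick U]>%VS.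
  apply/esym/eqP; rewrite eqEdim -memvE memv_pick dimU dim_vline x_nz.
  by [].
have xT_nz : (vpick U)^T != 0 by rewrite trmx_eq0.
have [a [v [a_nz v_norm xE]]] := normalized_multiple xT_nz.
have line_eq (c : 'F_p) (x y : 'cV['F_p]_k) : c != 0 -> x = c *: y -> (<[x]> = <[y]>)%VS.
  move=> c_nz ->; apply/eqP; rewrite eqEsubv -!memvE memvZ ?memv_line //=.
  rewrite -[y in y \in _](scale1r y) -(mulVf c_nz) -scalerA memvZ // memv_line.
  by [].
have [j ej] := e_onto v v_norm.
have colj : col j G = v^T by rewrite -[LHS]trmxK colG ej.
exists j; split.
  rewrite UE; apply: (line_eq a) => //.
  by rewrite colj -[LHS]trmxK xE linearZ.
move=> j' Uj'; apply: e_inj.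
(* Two columns spanning the same line are proportional normalized vectors, hence equal. *)
have /vlineP[c cE] : col j G \in <[col j' G]>%VS.
  rewrite -Uj' UE; have -> : col j G = a^-1 *: vpick U.
    by rewrite colj -[vpick U]trmxK xE linearZ /= scalerA mulVf // scale1r.
  by rewrite memvZ // memv_line.
apply: (normalized_scale (a := c) (e_norm j) (e_norm j')).
by rewrite -!colG cE linearZ.
Qed.

Lemma uniform_repeat (p k n r : nat) (G : 'M['F_p]_(k, n)) :
  uniform 1 G -> uniform r (repeat_cols r G).
Proof.
move=> [G_norm G_card].
have colE t : col t (repeat_cols r G) = col (repeat_index t) G.
  by apply/colP => l; rewrite !mxE.
split=> [t|v v_norm]; first by rewrite colE.
have /cards1P[j0 Gj0] : #|[set t | (col t G)^T == v]| == 1%N by rewrite G_card.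
rewrite -[RHS](card_divn_ord r (ltn_ord j0)); apply: eq_card => t.
rewrite !inE colE; have /setP/(_ (repeat_index t)) := Gj0; rewrite !inE => ->.
by rewrite -val_eqE.
Qed.

(** [H] and the repeated [G] have the same columns with the same multiplicities, so a bijection of
    the indices matches them. *)
Lemma uniform_repetition (p k n N r : nat) (G : 'M['F_p]_(k, n))
    (H : 'M['F_p]_(k, N)) :
  prime p -> (0 < k)%N -> (0 < r)%N -> uniform 1 G -> uniform r H ->
  repetition_of k r [set u *m H | u : 'rV['F_p]_k] [set u *m G | u : 'rV['F_p]_k].
Proof.
move=> p_prime k_gt0 r_gt0 G_unif H_unif.
have rep_unif := uniform_repeat r G_unif.
exists G, [set u *m repeat_cols r G | u : 'rV['F_p]_k]; split.
- exact: uniform_generator G_unif.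
- exact: uniform_generator rep_unif.
have N_gt0 : (0 < n * r)%N.
  rewrite (uniform_length p_prime rep_unif) muln_gt0 r_gt0 andbT divn_gt0 ?subn_gt0 ?prime_gt1 //.
  by rewrite leq_sub2r // -[p in (p <= _)%N]expn1 leq_exp2l ?prime_gt1.
have card_eq : #|'I_N| = #|'I_(n * r)|.
  by rewrite !card_ord (uniform_length p_prime rep_unif) -(uniform_length p_prime H_unif).
have [i|f [f_bij fE]] := @fibre_bijection _ _ _ (fun i => (col i H)^T)
    (fun j => (col j (repeat_cols r G))^T) (Ordinal N_gt0) card_eq.
  by case: H_unif rep_unif => H_norm H_card [_ rep_card]; rewrite H_card // rep_card.
exists f; split=> //.
have mulE (u : 'rV['F_p]_k) : u *m H = colsub f (u *m repeat_cols r G).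
  by apply/rowP => i; rewrite [RHS]mxE !mulmx_dot fE.
apply/setP => x; apply/imsetP/imsetP => [[u _ ->]|[_ /imsetP[u _ ->] ->]].
  by exists (u *m repeat_cols r G); [exact: imset_f|exact: mulE].
by exists u => //; rewrite mulE.
Qed.

(** Read off from the last stage [j = k], where the blocks have size p^0 d' = d'. *)
Lemma LexMinus_uniform (p k d' : nat) (F : nat -> fsseq p) :
  prime p -> (1 < d')%N -> scrF F ->
  let L := LexMinus F (p ^ (k - 1) * d') k in
  exists2 H : 'M['F_p]_(k, size (active_coords L)), uniform d' H &
    Res L = [set u *m H | u : 'rV['F_p]_k].
Proof.
move=> p_prime d'_gt1 /scrF_basisB[b [xi [eta [ne_xe ->]]]].
set d := (p ^ (k - 1) * d')%N; set B := basisB p b xi eta => L.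
pose w l := wminus B d (p ^ l).
have [s st] : exists s, stage k d' b xi eta w k s by apply: stage_exists.
have memL x : x \in L <-> exists u : 'rV['F_p]_k, x = word w k u by apply: mem_LexMinus.
set act := active_coords L.
pose n := (\max_(x <- L) size x)%N.
have size_L x : x \in L -> (size x <= n)%N by move=> xL; apply: leq_bigmax_seq.
have size_w l : (l < k)%N -> (size (w l) <= n)%N.
  move=> lt_l; apply: size_L; apply/memL; exists (delta_mx 0 (Ordinal lt_l)).
  rewrite /word (bigD1 (Ordinal lt_l)) //= mxE !eqxx scale1r big1 ?addr0 // => m.
  by move=> /andP[_ /negPf ne_m]; rewrite mxE ne_m andbF scale0r.
(* A nonzero column pairs to 1 with some message, so the corresponding code word is nonzero
   there. *)
have actE i : (i \in act) = (i < n)%N && (column k w k i != 0).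
  rewrite mem_filter mem_iota add0n andbC /= -/n; congr (_ && _).
  apply/hasP/idP => [[x /memL[u ->]]|col_nz].
    by rewrite coef_word; apply: contraNneq => ->; rewrite dot0r.
  have [u uE] := dot_eq1 col_nz; exists (word w k u); first by apply/memL; exists u.
  by rewrite coef_word uE oner_eq0.
pose H := \matrix_(l < k, t < size act) (w l)`_(nth 0%N act t).
have colH t : (col t H)^T = column k w k (nth 0%N act t).
  by apply/rowP => l; rewrite !mxE ltn_ord.
exists H.
  split=> [t|v v_norm].
    rewrite colH; apply: (stage_norm st).
    by have := mem_nth 0%N (ltn_ord t); rewrite actE => /andP[].
  under eq_finset => t do rewrite colH.
  rewrite (card_ord_nth 0%N act (fun i => column k w k i == v)).
  rewrite -[RHS](_ : (p ^ (k - k) * d')%N = d'); last by rewrite subnn mul1n.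
  rewrite -(stage_block st size_w v_norm) count_filter.
  rewrite (card_ord_iota n (fun i => column k w k i == v)).
  apply: eq_in_count => i; rewrite mem_iota /= => lt_in.
  have [col_v|//] := eqVneq (column k w k i) v; rewrite andTb.
  apply/hasP; have [u uE] := dot_eq1 (normalized_neq0 v_norm).
  exists (word w k u); first by apply/memL; exists u.
  by rewrite coef_word col_v uE oner_eq0.
apply/setP => y; rewrite inE; apply/mapP/imsetP => [[x /memL[u ->] ->]|[u _ ->]].
  by exists u => //; apply/rowP => t; rewrite mulmx_dot colH mxE coef_word.
exists (word w k u); first by apply/memL; exists u.
by apply/rowP => t; rewrite mulmx_dot colH mxE coef_word.
Qed.

Theorem theorem1p10 (p k d d' : nat) (F : nat -> fsseq p)
    (hp : prime p) (hk : (1 <= k)%N) (hd' : (2 <= d')%N)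
    (hd : d = (p ^ (k - 1) * d')%N) (hF : scrF F) :
  let n := ((p ^ k - 1) %/ (p - 1))%N in
  let C := Res (LexMinus F d k) in
  is_code C (n * d')%N k (p ^ (k - 1) * d')%N /\
  exists S : {set 'rV['F_p]_n},
    [/\ is_simplex_code k S,
        is_code S n k (p ^ (k - 1))%N &
        repetition_of k d' C S].
Proof.
rewrite hd => n; have [H H_unif ->] := LexMinus_uniform k hp hd' hF.
have d'_gt0 : (0 < d')%N by apply: ltnW.
have [G G_unif G_simplex] := simplex_exists hp (erefl n).
split.
  have [_ H_code] := uniform_is_code hp hk d'_gt0 H_unif.
  by split=> //; apply: uniform_length hp H_unif.
exists [set u *m G | u : 'rV['F_p]_k]; split.
- by exists G; split=> //; apply: uniform_generator G_unif.
(* The simplex code is the case of blocks of size 1. *)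
- rewrite -[(p ^ (k - 1))%N]muln1.
  exact: (uniform_is_code hp hk (ltn0Sn 0) G_unif).
exact: uniform_repetition.
Qed.
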